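(* Consider the following theorem (Abrahamse's Theorem for matrix-valued symbols). Suppose $\Phi=\Phi_-^*+\Phi_+\in L^\infty_{M_n}$ is such that $\Phi$ and $\Phi^*$ are of bounded type, with $\Phi_+=A^*\Theta_0\Theta_2$ and $\Phi_-=B^*\Theta_2$, where $\Theta_i=\theta_i I_n$ with $\theta_i$ an inner function ($i=0,2$) and $A,B\in H^2_{M_n}$. Assume that $A$ and $\Theta_2$ are left coprime and that $B$ and $\Theta_2$ are left coprime. If $T_\Phi$ is hyponormal and $\ker\,[T_\Phi^*,T_\Phi]$ is invariant under $T_\Phi$, then $T_\Phi$ is normal or analytic. This theorem may fail if the condition ''$B$ and $\Theta_2$ are left coprime'' is dropped, even though $A$ and $\Theta_2$ are left coprime. Indeed, let $\theta$ be a nonconstant finite Blaschke product, let $$\Phi=\begin{bmatrix} 2\theta+\overline\theta&\overline\theta\\ \overline\theta&2\theta+\overline\theta\end{bmatrix},\qquad \Theta:=\begin{bmatrix}\theta&0\\0&\theta\end{bmatrix}.$$ Then $$\Phi_+=2\Theta\quad\text{and}\quad \Phi_-=\begin{bmatrix}\theta&\theta\\ \theta&\theta\end{bmatrix}=\begin{bmatrix}1&1\\1&1\end{bmatrix}^*\Theta$$ (so $n=2$, $\Theta_2=\Theta$, $\Theta_0=I_2$, $A=2I_2$, $B=\begin{bmatrix}1&1\\1&1\end{bmatrix}$). Here $\Phi$ is normal, and $K:=\frac12\begin{bmatrix}1&1\\1&1\end{bmatrix}$ satisfies $\|K\|_\infty=1$ and $\Phi-K\Phi^*\in H^\infty_{M_2}$,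 so $T_\Phi$ is hyponormal. Moreover, $$\ker\,[T_\Phi^*,T_\Phi]=\Theta H^2_{\mathbb C^2}\oplus\{f\oplus f: f\in\mathcal H_\theta\},$$ and this subspace is invariant under $T_\Phi$. However, it is not all of $H^2_{\mathbb C^2}$, so $T_\Phi$ is not normal (and $T_\Phi$ is not analytic). The matrices $\begin{bmatrix}1&1\\1&1\end{bmatrix}$ and $\Theta$ are not left coprime.
   Context: $L^2_{\mathbb C^n}$ and $H^2_{\mathbb C^n}$ are the $\mathbb C^n$-valued $L^2$ and Hardy spaces on the unit circle $\mathbb T$. $L^\infty_{M_n}$, $H^\infty_{M_n}$, $H^2_{M_n}$ are the $n\times n$ matrix functions with entries in $L^\infty(\mathbb T)$, $H^\infty$, $H^2$; similarly $H^2_{M_{n\times m}}$ and $H^\infty_{M_{n\times m}}$ for $n\times m$ matrices. $\Phi^*$ is the pointwise adjoint; $\Phi$ is normal if $\Phi^*\Phi=\Phi\Phi^*$; $\|K\|_\infty:=\sup_{t\in\mathbb T}\|K(t)\|$ with the operator norm. $P_n$ is the orthogonal projection of $L^2$ onto $H^2$ (applied to vector- or matrix-valued functions), $P_n^\perp=I-P_n$, $\Phi_+:=P_n\Phi$ and $\Phi_-:=(P_n^\perp\Phi)^*$, so $\Phi=\Phi_-^*+\Phi_+$. $\Phi$ is of bounded type if each entry is a quotient of two bounded analytic functions on the unit disk (a.e. on $\mathbb T$). The block Toeplitz operator $T_\Phi$ on $H^2_{\mathbb C^n}$ is $T_\Phi F=P_n(\Phi F)$; it is called analytic if $\Phi\in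 H^\infty_{M_n}$. An operator $T$ is hyponormal if its self-commutator $[T^*,T]:=T^*T-TT^*$ is positive semidefinite. For a scalar inner function $\theta$, $\mathcal H_\theta:=H^2\ominus\theta H^2$. A matrix function $\Delta\in H^\infty_{M_{n\times m}}$ is inner if $\Delta(z)^*\Delta(z)=I_m$ for a.e. $z\in\mathbb T$. An inner matrix function $\Delta\in H^2_{M_{n\times m}}$ ($m\le n$) is a left inner divisor of $\Psi\in H^2_{M_{n\times r}}$ if $\Psi=\Delta C$ for some $C\in H^2_{M_{m\times r}}$. Two matrix functions are left coprime if their only common left inner divisor is a unitary constant.
   Formalization: The identities Φ₊=2Θ, Φ₋=θJ (J all-ones), and the choice A=2I, B=J, are stated only when θ(0)=0; otherwise PΦ=2Θ+conj(θ(0))J, so they fail. For general θ the formal text gives Φ=(θJ)*+2Θ and other A, B meeting the hypotheses, B and Θ not left coprime. *)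

(* Defs.v *)
(* MathComp-Analysis, with complex numbers R[i] over a realType R. *)
From HB Require Import structures.
From mathcomp Require Import all_boot all_order all_algebra.
From mathcomp Require Import complex.
From mathcomp Require Import all_classical all_reals all_analysis.

Set Implicit Arguments.
Unset Strict Implicit.
Unset Printing Implicit Defensive.

Import Order.TTheory GRing.Theory Num.Theory.
Import numFieldNormedType.Exports.

Local Open Scope classical_set_scope.
Local Open Scope ring_scope.
Local Open Scope sesquilinear_scope.

(* A function on the unit circle T is represented by a function on R[i] of
   which only the values at |z| = 1 matter; elements of L^2, H^2, ... are such
   representatives, and identities between them are stated up to [eqT], equality
   almost everywhere on T. *)

Section Circle.
Variable R : realType.
Local Notation C := R[i].
Local Notation mu := (@lebesgue_measure R).

Definition cis (t : R) : C := Complex (cos t) (sin t).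

Definition angles : set R := `[0, 2 * pi].

Definition aeT (P : C -> Prop) : Prop :=
  {ae mu, forall t, angles t -> P (cis t)}.

Definition eqT (V : Type) (f g : C -> V) : Prop := aeT (fun z => f z = g z).

Definition measurableT (f : C -> C) : Prop :=
  measurable_fun angles (fun t => complex.Re (f (cis t))) /\
  measurable_fun angles (fun t => complex.Im (f (cis t))).

(* integral for the normalized arc length measure *)
Definition intT (f : C -> C) : C :=
  Complex ((2 * pi)^-1 * \int[mu]_(t in angles) complex.Re (f (cis t)))
          ((2 * pi)^-1 * \int[mu]_(t in angles) complex.Im (f (cis t))).

Definition fourier (f : C -> C) (k : int) : C := intT (fun z => f z * z ^ (- k)).

Definition L2 : set (C -> C) := [set f | measurableT f /\
  (\int[mu]_(t in angles) (ComplexField.Normc.normc (f (cis t)) ^+ 2)%:E < +oo)%E].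

Definition Linf : set (C -> C) := [set f | measurableT f /\
  exists M : R, aeT (fun z => ComplexField.Normc.normc (f z) <= M)].

Definition H2 : set (C -> C) :=
  [set f | L2 f /\ forall k : int, k < 0 -> fourier f k = 0].

(* bounded analytic functions on the disk, identified with their boundary values *)
Definition Hinf : set (C -> C) := Linf `&` H2.

Definition bounded_type : set (C -> C) := [set f |
  exists g h, [/\ Hinf g, Hinf h & aeT (fun z => h z != 0 /\ f z = g z / h z)]].

Definition scalar_inner (th : C -> C) : Prop :=
  Hinf th /\ aeT (fun z => `|th z| = 1).

(* H_theta = H^2 (-) theta H^2 *)
Definition Hmodel (th : C -> C) : set (C -> C) := [set f | H2 f /\
  forall g, H2 g -> intT (fun z => f z * (th z * g z)^*) = 0].

Definition finite_blaschke (th : C -> C) : Prop :=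
  exists (c : C) (s : seq C), [/\ `|c| = 1, all (fun a => `|a| < 1) s &
    forall z, `|z| <= 1 -> th z = c * \prod_(a <- s) ((z - a) / (1 - a^* * z))].

Definition nonconstant (th : C -> C) : Prop :=
  ~ exists c, forall z, `|z| <= 1 -> th z = c.

End Circle.

Section MatrixFunctions.
Variable R : realType.
Local Notation C := R[i].
Local Notation mxfun n m := (C -> 'M[C]_(n, m)).
Local Notation vecfun n := (C -> 'cV[C]_n).

(* matrix functions with all entries in S *)
Definition entries (S : set (C -> C)) n m : set (mxfun n m) :=
  [set F | forall i j, S (fun z => F z i j)].

Definition fadj n m (F : mxfun n m) : mxfun m n := fun z => (F z)^t*.

Definition fscalar n (th : C -> C) : mxfun n n := fun z => (th z)%:M.

Definition normal_symbol n (Phi : mxfun n n) : Prop :=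
  aeT (fun z => (Phi z)^t* *m Phi z = Phi z *m (Phi z)^t*).

(* operator norm of a matrix, for the Euclidean norms *)
Definition vnorm n (v : 'cV[C]_n) : R :=
  Num.sqrt (\sum_i ComplexField.Normc.normc (v i 0) ^+ 2).

Definition opnorm n m (A : 'M[C]_(n, m)) : \bar R :=
  ereal_sup [set (vnorm (A *m v))%:E | v in [set v : 'cV[C]_m | vnorm v <= 1]].

Definition norm_inf n m (K : mxfun n m) : \bar R :=
  ereal_sup [set opnorm (K z) | z in [set z : C | `|z| = 1]].

Definition inner_prod n m (F G : mxfun n m) : C :=
  \sum_i \sum_j intT (fun z => F z i j * (G z i j)^*).

(* The orthogonal projection P_n of L^2 onto H^2: the F' in H^2 with
   F - F' orthogonal to H^2, which is unique up to [eqT]. *)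
Definition proj n m (F : mxfun n m) : mxfun n m :=
  xget (fun=> 0) [set F' | entries (@H2 R) F' /\
    forall G, entries (@H2 R) G -> inner_prod (fun z => F z - F' z) G = 0].

Definition plus_part n (Phi : mxfun n n) : mxfun n n := proj Phi.

Definition minus_part n (Phi : mxfun n n) : mxfun n n :=
  fadj (fun z => Phi z - proj Phi z).

(* Operators on H^2_{C^n} act on representatives. *)
Definition oper n := vecfun n -> vecfun n.

Definition toeplitz n (Phi : mxfun n n) : oper n :=
  fun F => proj (fun z => Phi z *m F z).

(* Hilbert space adjoint of T on H^2_{C^n}; its value at each F in H^2_{C^n}
   is unique up to [eqT]. *)
Definition adjoint n (T : oper n) : oper n :=
  xget (fun=> fun=> 0) [set S | forall F, entries (@H2 R) F ->
    entries (@H2 R) (S F) /\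
    forall G, entries (@H2 R) G -> inner_prod (T G) F = inner_prod G (S F)].

Definition selfcomm n (T : oper n) : oper n :=
  fun F z => adjoint T (T F) z - T (adjoint T F) z.

Definition hyponormal n (T : oper n) : Prop :=
  forall F, entries (@H2 R) F -> 0 <= inner_prod (selfcomm T F) F.

Definition normal_oper n (T : oper n) : Prop :=
  forall F, entries (@H2 R) F -> eqT (selfcomm T F) (fun=> 0).

Definition oker n (T : oper n) : set (vecfun n) :=
  [set F | entries (@H2 R) F /\ eqT (T F) (fun=> 0)].

Definition invariant_under n (T : oper n) (M : set (vecfun n)) : Prop :=
  forall F, M F -> M (T F).

(* M is the orthogonal direct sum of M1 and M2 inside H^2_{C^n}; the condition
   that F is in H^2 excludes non-measurable representatives. *)
Definition orth_sum n (M M1 M2 : set (vecfun n)) : Prop :=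
  (forall F1 F2, M1 F1 -> M2 F2 -> inner_prod F1 F2 = 0) /\
  forall F, M F <-> entries (@H2 R) F /\
    exists F1 F2, [/\ M1 F1, M2 F2 & eqT F (fun z => F1 z + F2 z)].

(* T_Phi is called analytic *)
Definition analytic_symbol n (Phi : mxfun n n) : Prop := entries (@Hinf R) Phi.

Definition mx_inner n m (D : mxfun n m) : Prop :=
  entries (@Hinf R) D /\ aeT (fun z => (D z)^t* *m D z = 1%:M).

Definition left_inner_divisor n m r (D : mxfun n m) (Psi : mxfun n r) : Prop :=
  [/\ (m <= n)%N, mx_inner D &
    exists G : mxfun m r, entries (@H2 R) G /\ eqT Psi (fun z => D z *m G z)].

(* A unitary constant is square: for U of size n x m with m <= n, U U^* = 1
   forces m = n. *)
Definition left_coprime n r s (A : mxfun n r) (B : mxfun n s) : Prop :=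
  forall m (D : mxfun n m), left_inner_divisor D A -> left_inner_divisor D B ->
  exists U : 'M[C]_(n, m),
    [/\ m = n, U *m U^t* = 1%:M, U^t* *m U = 1%:M & eqT D (fun=> U)].

(* The hypotheses of Abrahamse's theorem for matrix-valued symbols, except
   that B and Theta_2 = th2 I_n are left coprime. *)
Definition abrahamse_hyp n (Phi A B : mxfun n n) (th0 th2 : C -> C) : Prop :=
  entries (@Linf R) Phi /\
  entries (@bounded_type R) Phi /\ entries (@bounded_type R) (fadj Phi) /\
  scalar_inner th0 /\ scalar_inner th2 /\
  entries (@H2 R) A /\ entries (@H2 R) B /\
  eqT (plus_part Phi)
      (fun z => (A z)^t* *m fscalar n th0 z *m fscalar n th2 z) /\
  eqT (minus_part Phi) (fun z => (B z)^t* *m fscalar n th2 z) /\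
  left_coprime A (fscalar n th2) /\
  hyponormal (toeplitz Phi) /\
  invariant_under (toeplitz Phi) (oker (selfcomm (toeplitz Phi))).

Definition abrahamse_concl n (Phi : mxfun n n) : Prop :=
  normal_oper (toeplitz Phi) \/ analytic_symbol Phi.

(* The theorem with the condition "B and Theta_2 are left coprime" dropped *)
Definition abrahamse_without_B_coprime : Prop :=
  forall n (Phi A B : mxfun n n) (th0 th2 : C -> C), (0 < n)%N ->
    abrahamse_hyp Phi A B th0 th2 -> abrahamse_concl Phi.

Definition mx2 (a b c d : C) : 'M[C]_2 :=
  \matrix_(i, j) if i == 0 then (if j == 0 then a else b)
                 else (if j == 0 then c else d).

Definition ones2 : 'M[C]_2 := mx2 1 1 1 1.

Definition ex_Phi (th : C -> C) : mxfun 2 2 := fun z =>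
  mx2 (2 * th z + (th z)^*) (th z)^*
      (th z)^*              (2 * th z + (th z)^*).

Definition ex_Theta (th : C -> C) : mxfun 2 2 := fun z => mx2 (th z) 0 0 (th z).

Definition ex_K : mxfun 2 2 := fun=> 2^-1 *: ones2.

(* Theta H^2_{C^2} *)
Definition ThetaH2 (th : C -> C) : set (vecfun 2) :=
  [set F | exists2 G, entries (@H2 R) G & F = (fun z => ex_Theta th z *m G z)].

(* { f (+) f : f in H_theta } *)
Definition diag_model (th : C -> C) : set (vecfun 2) :=
  [set F | exists2 f, Hmodel th f & F = (fun z => \col_(i < 2) f z)].

End MatrixFunctions.

(* Main.v *)
Require Import Defs.
From mathcomp Require Import all_boot all_order all_algebra.
From mathcomp Require Import complex ring lra.
From mathcomp Require Import all_classical all_reals all_analysis measurable_realfun.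

(* Write th for the Blaschke product, J for ones2, and for f in H^2 let l be the
   projection of th^* f on H^2, so that f = th l + q with q in H_theta. Then
   T F = 2 th F + l(J F), T^* F = 2 l(F) + th J F, and these give
   [T^*, T] F = (4 - J^2) q = (4 - 2 J) q: the self-commutator is nonnegative and
   its kernel is {F : q_0 = q_1}.
   No completeness of L^2 is needed for projections: for one factor b_a,
   P(b_a^* f) = b_a^* (f - c k_a), with k_a the Szego kernel and c chosen so that
   f - c k_a vanishes at a, and products follow by induction on the factors.
   If th(0) <> 0, then A = 2 I + th(0) th J and B = (1 - th(0)^* th) J.
   Left coprimality of A and Theta: a common inner divisor D divides 2 I, so D and D^*
   are both in H^2 and D is constant, by uniqueness of Fourier coefficients. *)

(** [proj] and [adjoint] are chosen by [xget], so nothing is known of their values until a function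
    with the defining property has been exhibited. Projections are therefore handled through the
    relation [hproj], existence is proved from the form of th, and operator identities come from
    uniqueness up to [eqT]. The number th(0) enters because the projection of conj th on H^2 is the
    constant conj th(0). Thus Phi_+ is 2 Theta only when th(0) = 0; in general Phi_+ = 2 th I + conj
    th(0) J, and the constant has to be absorbed into A and B. The negative claims are tested at one
    zero a of th in the disk. The Szego kernel k_a is orthogonal to th H^2, which shows at once that
    th is not constant, that conj th is not in H^2 and that (k_a, 0) lies outside the kernel.
    Uniqueness of Fourier coefficients is reached without a summability kernel: bounded
    trigonometric polynomials converge to indicators of arcs, and the primitive of the function is
    then differentiated almost everywhere. *)

Set Implicit Arguments.
Unset Strict Implicit.
Unset Printing Implicit Defensive.
Import Order.TTheory GRing.Theory Num.Theory.
Import numFieldNormedType.Exports.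
Local Open Scope classical_set_scope.
Local Open Scope ring_scope.
Local Open Scope sesquilinear_scope.

(** * Integrals and square-integrable functions on the circle *)

Section ComplexParts.
Variable R : rcfType.
Implicit Types x y : R[i].

Lemma complex_ext x y :
  complex.Re x = complex.Re y -> complex.Im x = complex.Im y -> x = y.
Proof. by case: x y => a b [c d] /= -> ->. Qed.

Lemma cReD x y : complex.Re (x + y) = complex.Re x + complex.Re y.
Proof. by case: x y => a b []. Qed.

Lemma cImD x y : complex.Im (x + y) = complex.Im x + complex.Im y.
Proof. by case: x y => a b []. Qed.

Lemma cReM x y :
  complex.Re (x * y) = complex.Re x * complex.Re y - complex.Im x * complex.Im y.
Proof. by case: x y => a b []. Qed.

Lemma cImM x y :
  complex.Im (x * y) = complex.Re x * complex.Im y + complex.Im x * complex.Re y.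
Proof. by case: x y => a b []. Qed.

Lemma cRe_conj x : complex.Re x^* = complex.Re x.
Proof. by case: x. Qed.

Lemma cIm_conj x : complex.Im x^* = - complex.Im x.
Proof. by case: x. Qed.

(** The squared modulus as a real polynomial in the two parts, a form open to [nra] and to real
    integration. *)
Definition sqn x : R := complex.Re x ^+ 2 + complex.Im x ^+ 2.

Lemma normc_sqr x : ComplexField.Normc.normc x ^+ 2 = sqn x.
Proof. by case: x => a b; rewrite /= sqr_sqrtr ?addr_ge0 ?sqr_ge0. Qed.

Lemma sqn_ge0 x : 0 <= sqn x.
Proof. by rewrite addr_ge0 ?sqr_ge0. Qed.

Lemma sqn_eq0 x : sqn x = 0 -> x = 0.
Proof.
move/eqP; rewrite paddr_eq0 ?sqr_ge0 ?expf_eq0 //= => /andP[/eqP a /eqP b].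
exact: complex_ext.
Qed.

Lemma sqnM x y : sqn (x * y) = sqn x * sqn y.
Proof. by rewrite /sqn cReM cImM; ring. Qed.

Lemma sqnD_le x y : sqn (x + y) <= 2 * (sqn x + sqn y).
Proof.
rewrite /sqn cReD cImD; case: x y => [a b] [c d] /=.
have := sqr_ge0 (a - c); have := sqr_ge0 (b - d); nra.
Qed.

Lemma normr_ReM_le x y : `|complex.Re (x * y)| <= sqn x + sqn y.
Proof.
rewrite cReM /sqn; case: x y => [a b] [c d] /=.
have := sqr_ge0 (a - c); have := sqr_ge0 (b - d).
have := sqr_ge0 (a + c); have := sqr_ge0 (b + d).
by move=> *; rewrite ler_norml; apply/andP; split; nra.
Qed.

Lemma normr_ImM_le x y : `|complex.Im (x * y)| <= sqn x + sqn y.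
Proof.
rewrite cImM /sqn; case: x y => [a b] [c d] /=.
have := sqr_ge0 (a - d); have := sqr_ge0 (b - c).
have := sqr_ge0 (a + d); have := sqr_ge0 (b + c).
by move=> *; rewrite ler_norml; apply/andP; split; nra.
Qed.

Lemma normCK_sqn x : x * x^* = (sqn x)%:C%C.
Proof.
by apply: complex_ext; rewrite ?cReM ?cImM ?cRe_conj ?cIm_conj /= /sqn; ring.
Qed.

Lemma norm1_sqn x : `|x| = 1 -> sqn x = 1.
Proof.
move=> x1; have : `|x| ^+ 2 = 1 by rewrite x1 expr1n.
by rewrite normCK normCK_sqn => -[].
Qed.

Lemma norm1_mulJ x : `|x| = 1 -> x * x^* = 1.
Proof. by move=> x1; rewrite -normCK x1 expr1n. Qed.

Lemma normr_normc x : `|x| = (ComplexField.Normc.normc x)%:C%C.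
Proof. by case: x. Qed.

End ComplexParts.

Section CircleIntegral.
Variable R : realType.
Local Notation C := R[i].
Local Notation mu := (@lebesgue_measure R).
Local Notation angles := (@angles R).
Local Notation intT := (@intT R).
Local Notation measurableT := (@Defs.measurableT R).
Implicit Types f g h u : C -> C.

Lemma measurable_angles : measurable angles.
Proof. exact: measurable_itv. Qed.
Hint Resolve measurable_angles : core.

Lemma pi2_gt0 : 0 < 2 * pi :> R.
Proof. by rewrite mulr_gt0 ?pi_gt0. Qed.

Lemma lebesgue_angles : mu angles = (2 * pi)%:E.
Proof. by rewrite lebesgue_measure_itv /= lte_fin pi2_gt0 -EFinB subr0. Qed.

Lemma norm_cis (t : R) : `|cis t| = 1.
Proof. by rewrite normr_normc /= cos2Dsin2 sqrtr1. Qed.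

Lemma circle_cis (P : C -> Prop) :
  (forall z, `|z| = 1 -> P z) -> forall t : R, P (cis t).
Proof. by move=> H t; apply: H; rewrite norm_cis. Qed.

Lemma aeT_circle (P : C -> Prop) : (forall z, `|z| = 1 -> P z) -> aeT P.
Proof. by move=> H; apply: aeW => t _; apply: circle_cis. Qed.

Lemma aeTW (P Q : C -> Prop) : (forall z, `|z| = 1 -> P z -> Q z) -> aeT P -> aeT Q.
Proof. by move=> H; rewrite /aeT; apply: filterS; [exact: (ae_filter_ringOfSetsType mu)|] => t + At => /(_ At); apply: H; rewrite norm_cis. Qed.

Lemma aeT_and (P Q : C -> Prop) : aeT P -> aeT Q -> aeT (fun z => P z /\ Q z).
Proof. by rewrite /aeT; apply: filterS2; [exact: (ae_filter_ringOfSetsType mu)|] => t HP HQ At; split; [apply: HP|apply: HQ]. Qed.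

Lemma circle_funext (V : Type) (f g : C -> V) :
  (forall z, `|z| = 1 -> f z = g z) -> f \o @cis R = g \o @cis R.
Proof. by move=> H; apply/funext; apply: (circle_cis H). Qed.

(** The class on which [intT] is linear; it contains the products of two [L2] functions, which need
    not be in [L2]. *)
Definition itg f := mu.-integrable angles (EFin \o (fun t => complex.Re (f (cis t)))) /\
  mu.-integrable angles (EFin \o (fun t => complex.Im (f (cis t)))).

Lemma measT_congr f g :
  (forall z, `|z| = 1 -> f z = g z) -> measurableT f -> measurableT g.
Proof.
move=> /circle_funext E [mr mi]; split.
  by rewrite (_ : (fun _ => _) = @complex.Re R \o (g \o @cis R)) // -E.
by rewrite (_ : (fun _ => _) = @complex.Im R \o (g \o @cis R)) // -E.
Qed.

Lemma intT_congr f g :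
  (forall z, `|z| = 1 -> f z = g z) -> intT f = intT g.
Proof.
by move=> E; congr (Complex (_ * _) (_ * _)); apply: eq_Rintegral => t _;
  rewrite E // norm_cis.
Qed.

Lemma L2_congr f g : (forall z, `|z| = 1 -> f z = g z) -> L2 f -> L2 g.
Proof.
move=> E [mf lf]; split; first exact: measT_congr mf.
under eq_integral => t _ do rewrite -E ?norm_cis //.
exact: lf.
Qed.

Lemma measT_cst (c : C) : measurableT (fun=> c).
Proof. by split; exact: measurable_cst. Qed.

Lemma measTD f g : measurableT f -> measurableT g ->
  measurableT (fun z => f z + g z).
Proof.
move=> [fr fi] [gr gi]; split.
  by under eq_fun do rewrite cReD; exact: measurable_funD.
by under eq_fun do rewrite cImD; exact: measurable_funD.
Qed.

Lemma measTM f g : measurableT f -> measurableT g ->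
  measurableT (fun z => f z * g z).
Proof.
move=> [fr fi] [gr gi]; split.
  under eq_fun do rewrite cReM.
  by apply: measurable_funB; exact: measurable_funM.
under eq_fun do rewrite cImM.
by apply: measurable_funD; exact: measurable_funM.
Qed.

Lemma measTJ f : measurableT f -> measurableT (fun z => (f z)^*).
Proof.
move=> [fr fi]; split; first by under eq_fun do rewrite cRe_conj.
by under eq_fun do rewrite cIm_conj; exact: measurable_funN.
Qed.

Lemma measTZ (c : C) f : measurableT f -> measurableT (fun z => c * f z).
Proof. by apply: measTM; exact: measT_cst. Qed.

Lemma measT_id : measurableT (fun z : C => z).
Proof.
split => /=; apply: measurable_funTS; apply: continuous_measurable_fun.
  exact: continuous_cos.
exact: continuous_sin.
Qed.

Lemma measT_sqn f : measurableT f ->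
  measurable_fun angles (fun t => sqn (f (cis t))).
Proof. by move=> [fr fi]; exact: (measurable_funD (measurable_funX 2 fr) (measurable_funX 2 fi)). Qed.

(** Inversion reduces to the real case by 1 / f = conj f / |f|^2, and the real inverse is the power
    with exponent -1. *)
Lemma measTV f : measurableT f -> (forall z, `|z| = 1 -> f z != 0) ->
  measurableT (fun z => (f z)^-1).
Proof.
move=> mf f0.
have mi : measurable_fun angles (fun t => (sqn (f (cis t)))^-1).
  under eq_fun => t do rewrite -powR_inv1 ?sqn_ge0 //.
  exact: (measurableT_comp (measurable_powR (-1)) (measT_sqn mf)).
suff : measurableT (fun z => (f z)^* * ((sqn (f z))^-1)%:C%C).
  apply: measT_congr => z z1.
  apply: (mulfI (f0 z z1)); rewrite mulfV ?f0 // mulrA normCK_sqn.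
  rewrite -rmorphM mulfV //; apply: contra (f0 z z1) => /eqP /sqn_eq0 ->.
  exact: eqxx.
apply: measTM; first exact: measTJ.
by split => //=; exact: measurable_cst.
Qed.

Lemma integrable_le (f g : R -> R) : measurable_fun angles f ->
  (forall t, `|f t| <= g t) -> mu.-integrable angles (EFin \o g) ->
  mu.-integrable angles (EFin \o f).
Proof.
move=> mf fg; apply: le_integrable => //; first exact/measurable_EFinP.
by move=> t _ /=; rewrite lee_fin (le_trans (fg t)) // ler_norm.
Qed.

Lemma L2P f : L2 f <-> measurableT f /\
  mu.-integrable angles (EFin \o (fun t => sqn (f (cis t)))).
Proof.
have E : (fun t : R => (ComplexField.Normc.normc (f (cis t)) ^+ 2)%:E)
   = EFin \o (fun t => sqn (f (cis t))).
  by apply/funext => t /=; rewrite normc_sqr.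
rewrite /L2 /= E; split=> -[mf lf]; split => //.
  apply/integrableP; split.
    by apply/measurable_EFinP; exact: measT_sqn.
  by under eq_integral => t _ do rewrite /= ger0_norm ?sqn_ge0 //.
move/integrableP: lf => [_].
by under eq_integral => t _ do rewrite /= ger0_norm ?sqn_ge0 //.
Qed.

Lemma L2_measurable f : L2 f -> measurableT f.
Proof. by case. Qed.

Lemma itg_le f (g : R -> R) : measurableT f ->
  (forall t, `|complex.Re (f (cis t))| <= g t) ->
  (forall t, `|complex.Im (f (cis t))| <= g t) ->
  mu.-integrable angles (EFin \o g) -> itg f.
Proof. by move=> [mr mi] Hr Hi ig; split; apply: integrable_le ig. Qed.

Lemma integrableRD (u v : R -> R) : mu.-integrable angles (EFin \o u) ->
  mu.-integrable angles (EFin \o v) ->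
  mu.-integrable angles (EFin \o (fun t => u t + v t)).
Proof. by move=> iu iv; rewrite (_ : _ \o _ = (EFin \o u) \+ (EFin \o v))%E //; exact: integrableD. Qed.

Lemma integrableRZ (k : R) (v : R -> R) :
  mu.-integrable angles (EFin \o v) ->
  mu.-integrable angles (EFin \o (fun t => k * v t)).
Proof. by move=> iv; rewrite (_ : _ \o _ = (fun t => k%:E * (EFin \o v) t))%E //; exact: integrableZl. Qed.

Lemma itgM f g : L2 f -> L2 g -> itg (fun z => f z * g z).
Proof.
move=> /L2P[mf lf] /L2P[mg lg].
apply: (@itg_le _ (fun t => sqn (f (cis t)) + sqn (g (cis t)))).
- exact: measTM.
- by move=> t; apply: normr_ReM_le.
- by move=> t; apply: normr_ImM_le.
- exact: integrableRD.
Qed.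

Lemma L2J f : L2 f -> L2 (fun z => (f z)^*).
Proof.
move=> /L2P[mf lf]; apply/L2P; split; first exact: measTJ.
by under eq_fun do rewrite /sqn cRe_conj cIm_conj sqrrN.
Qed.

Lemma L2D f g : L2 f -> L2 g -> L2 (fun z => f z + g z).
Proof.
move=> /L2P[mf lf] /L2P[mg lg]; apply/L2P; split; first exact: measTD.
apply: (@integrable_le _ (fun t => 2 * (sqn (f (cis t)) + sqn (g (cis t))))).
- exact: (measT_sqn (measTD mf mg)).
- by move=> t; rewrite ger0_norm ?sqn_ge0 // sqnD_le.
- by apply: integrableRZ; exact: integrableRD.
Qed.

(** The bound holds at every point of the circle, not almost everywhere: the multipliers are
    explicit functions, and pointwise domination then suffices. *)
Definition bddT f := measurableT f /\ exists M : R, forall z, `|z| = 1 -> sqn (f z) <= M.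

Lemma L2_bddM u f : bddT u -> L2 f -> L2 (fun z => u z * f z).
Proof.
move=> [mu_ [M uM]] /L2P[mf lf]; apply/L2P; split; first exact: measTM.
apply: (@integrable_le _ (fun t => M * sqn (f (cis t)))).
- exact: (measT_sqn (measTM mu_ mf)).
- move=> t; rewrite ger0_norm ?sqn_ge0 // sqnM ler_wpM2r ?sqn_ge0 //.
  exact: uM (norm_cis t).
- exact: integrableRZ.
Qed.

Lemma bddT_cst (c : C) : bddT (fun=> c).
Proof. by split; [exact: measT_cst | exists (sqn c)]. Qed.

Lemma bddT_id : bddT (fun z : C => z).
Proof.
split; first exact: measT_id.
by exists 1 => z /norm1_sqn ->.
Qed.

Lemma bddTM u v : bddT u -> bddT v -> bddT (fun z => u z * v z).
Proof.
move=> [m1 [M H]] [m2 [N K]]; split; first exact: measTM.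
exists (M * N) => z z1; rewrite sqnM ler_pM ?sqn_ge0 ?H ?K //.
Qed.

Lemma bddTD u v : bddT u -> bddT v -> bddT (fun z => u z + v z).
Proof.
move=> [m1 [M H]] [m2 [N K]]; split; first exact: measTD.
exists (2 * (M + N)) => z z1.
by apply: le_trans (sqnD_le _ _) _; rewrite ler_wpM2l // lerD ?H ?K.
Qed.

Lemma bddTJ u : bddT u -> bddT (fun z => (u z)^*).
Proof.
move=> [m1 [M H]]; split; first exact: measTJ.
by exists M => z z1; rewrite /sqn cRe_conj cIm_conj sqrrN; apply: H.
Qed.

Lemma bddT_unimodular u : measurableT u -> (forall z, `|z| = 1 -> `|u z| = 1) -> bddT u.
Proof. by move=> mu_ H; split=> //; exists 1 => z /H /norm1_sqn ->. Qed.

Lemma bddT_congr u v : (forall z, `|z| = 1 -> u z = v z) -> bddT u -> bddT v.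
Proof.
move=> E [m1 [M H]]; split; first exact: measT_congr m1.
by exists M => z z1; rewrite -E // H.
Qed.

Lemma L2_cst (c : C) : L2 (fun=> c).
Proof.
apply/L2P; split; first exact: measT_cst.
apply/integrableP; split; first by apply/measurable_EFinP; exact: measurable_cst.
by rewrite integral_cst // [X in (_ * X)%E]lebesgue_angles /= -EFinM ltry.
Qed.

Lemma L2_bdd u : bddT u -> L2 u.
Proof. by move=> bu; move: (L2_bddM bu (L2_cst 1)); under eq_fun do rewrite mulr1. Qed.

Lemma Linf_bdd u : bddT u -> Linf u.
Proof.
move=> [mu_ [M H]]; split=> //; exists (Num.sqrt M); apply: aeT_circle => z z1.
rewrite -(@ler_pXn2r _ 2) ?nnegrE ?sqrtr_ge0 //; last by case: (u z) => *; exact: sqrtr_ge0.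
have Hz := H _ z1; have M0 := le_trans (sqn_ge0 _) Hz.
by rewrite normc_sqr sqr_sqrtr.
Qed.

Lemma L2Z (c : C) f : L2 f -> L2 (fun z => c * f z).
Proof. exact: L2_bddM (bddT_cst c). Qed.

Lemma L2N f : L2 f -> L2 (fun z => - f z).
Proof. by move=> /(L2Z (-1)); under eq_fun do rewrite mulN1r. Qed.

Lemma L2B f g : L2 f -> L2 g -> L2 (fun z => f z - g z).
Proof. by move=> lf lg; apply: L2D => //; exact: L2N. Qed.

Lemma L2_sum I (r : seq I) (P : pred I) (F : I -> C -> C) :
  (forall i, P i -> L2 (F i)) -> L2 (fun z => \sum_(i <- r | P i) F i z).
Proof.
move=> H; elim: r => [|i r IH]; first by under eq_fun do rewrite big_nil; exact: L2_cst.
under eq_fun do rewrite big_cons.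
by case: (boolP (P i)) => // Pi; apply: L2D => //; exact: H.
Qed.

Lemma itg_L2 f : L2 f -> itg f.
Proof. by move=> lf; move: (itgM lf (L2_cst 1)); under eq_fun do rewrite mulr1. Qed.

Lemma itg_measurable f : itg f -> measurableT f.
Proof. by move=> [/measurable_int/measurable_EFinP ? /measurable_int/measurable_EFinP ?]. Qed.

Lemma itg_congr f g : (forall z, `|z| = 1 -> f z = g z) -> itg f -> itg g.
Proof.
move=> /circle_funext E [mr mi]; split.
  by rewrite (_ : (fun _ => _) = @complex.Re R \o (g \o @cis R)) // -E.
by rewrite (_ : (fun _ => _) = @complex.Im R \o (g \o @cis R)) // -E.
Qed.

Lemma itgD f g : itg f -> itg g -> itg (fun z => f z + g z).
Proof.
move=> [fr fi] [gr gi]; split.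
  by under [fun t => _]eq_fun do rewrite cReD; exact: integrableRD.
by under [fun t => _]eq_fun do rewrite cImD; exact: integrableRD.
Qed.

Lemma itgZ (c : C) f : itg f -> itg (fun z => c * f z).
Proof.
move=> [fr fi]; split.
  under [fun t => _]eq_fun do rewrite cReM -mulNr.
  by apply: integrableRD; exact: integrableRZ.
under [fun t => _]eq_fun do rewrite cImM.
by apply: integrableRD; exact: integrableRZ.
Qed.

Lemma itg_bddM u f : bddT u -> itg f -> itg (fun z => u z * f z).
Proof.
move=> [mu_ [M uM]] [fr fi]; have [mr mi] := itg_measurable (conj fr fi).
(* a^2 + b^2 <= M gives |a|, |b| <= 1 + M, which avoids a square root. *)
apply: (@itg_le _ (fun t => (1 + M) * (`|complex.Re (f (cis t))| + `|complex.Im (f (cis t))|))).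
- by apply: measTM => //.
- move=> t; have := uM _ (norm_cis t); rewrite /sqn cReM.
  set a := complex.Re (u _); set b := complex.Im (u _) => H.
  apply: (le_trans (ler_normB _ _)); rewrite !normrM mulrDr.
  have Ha : `|a| <= 1 + M by rewrite ler_norml; apply/andP; split; nra.
  have Hb : `|b| <= 1 + M by rewrite ler_norml; apply/andP; split; nra.
  by apply: lerD; apply: ler_wpM2r.
- move=> t; have := uM _ (norm_cis t); rewrite /sqn cImM.
  set a := complex.Re (u _); set b := complex.Im (u _) => H.
  apply: (le_trans (ler_normD _ _)); rewrite !normrM addrC mulrDr.
  have Ha : `|a| <= 1 + M by rewrite ler_norml; apply/andP; split; nra.
  have Hb : `|b| <= 1 + M by rewrite ler_norml; apply/andP; split; nra.
  by apply: lerD; apply: ler_wpM2r.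
- apply: integrableRZ; apply: integrableRD.
    exact: (integrable_norm fr).
  exact: (integrable_norm fi).
Qed.

Lemma intTD f g : itg f -> itg g -> intT (fun z => f z + g z) = intT f + intT g.
Proof.
move=> [fr fi] [gr gi]; apply: complex_ext; rewrite ?cReD ?cImD /= -mulrDr; congr (_ * _).
  by rewrite -RintegralD //; apply: eq_Rintegral => t _; rewrite cReD.
by rewrite -RintegralD //; apply: eq_Rintegral => t _; rewrite cImD.
Qed.

Lemma intTZ (c : C) f : itg f -> intT (fun z => c * f z) = c * intT f.
Proof.
move=> [fr fi]; apply: complex_ext; rewrite ?cReM ?cImM /=.
  under eq_Rintegral => t _ do rewrite cReM.
  rewrite RintegralB ?RintegralZl //; try exact: integrableRZ.
  by ring.
under eq_Rintegral => t _ do rewrite cImM.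
rewrite RintegralD ?RintegralZl //; try exact: integrableRZ.
by ring.
Qed.

Lemma intTN f : itg f -> intT (fun z => - f z) = - intT f.
Proof. by move=> /(intTZ (-1)); rewrite mulN1r => <-; under eq_fun do rewrite -mulN1r. Qed.

Lemma itgN f : itg f -> itg (fun z => - f z).
Proof. by move=> /(itgZ (-1)); under eq_fun do rewrite mulN1r. Qed.

Lemma intTB f g : itg f -> itg g -> intT (fun z => f z - g z) = intT f - intT g.
Proof. by move=> lf lg; rewrite intTD ?intTN //; exact: itgN. Qed.

Lemma intTJ f : itg f -> intT (fun z => (f z)^*) = (intT f)^*.
Proof.
move=> [fr fi]; apply: complex_ext; rewrite ?cRe_conj ?cIm_conj /=.
  by congr (_ * _); apply: eq_Rintegral => t _; rewrite cRe_conj.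
under eq_Rintegral => t _ do rewrite cIm_conj -mulN1r.
by rewrite RintegralZl // mulN1r mulrN.
Qed.

Lemma itgJ f : itg f -> itg (fun z => (f z)^*).
Proof.
move=> [fr fi]; split; first by under [fun t => _]eq_fun do rewrite cRe_conj.
by under [fun t => _]eq_fun do rewrite cIm_conj -mulN1r; exact: integrableRZ.
Qed.

Lemma itg_sum I (r : seq I) (P : pred I) (F : I -> C -> C) :
  (forall i, P i -> itg (F i)) -> itg (fun z => \sum_(i <- r | P i) F i z).
Proof.
move=> H; elim: r => [|i r IH].
  by under eq_fun do rewrite big_nil; exact: itg_L2 (L2_cst _).
under eq_fun do rewrite big_cons.
by case: (boolP (P i)) => // Pi; apply: itgD => //; exact: H.
Qed.

Lemma intT_cst (c : C) : intT (fun=> c) = c.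
Proof.
have H (r : R) : (2 * pi)^-1 * \int[mu]_(t in angles) r = r.
  by rewrite Rintegral_cst // [X in fine X]lebesgue_angles /= mulrC mulfK // gt_eqF ?pi2_gt0.
by rewrite /intT !H; case: c.
Qed.

Lemma intT_sum I (r : seq I) (P : pred I) (F : I -> C -> C) :
  (forall i, P i -> itg (F i)) ->
  intT (fun z => \sum_(i <- r | P i) F i z) = \sum_(i <- r | P i) intT (F i).
Proof.
move=> H; elim: r => [|i r IH].
  by rewrite big_nil; under eq_fun do rewrite big_nil; exact: intT_cst.
rewrite big_cons; under eq_fun do rewrite big_cons.
case: (boolP (P i)) => // Pi; rewrite intTD ?IH //; first exact: H.
exact: itg_sum.
Qed.

Lemma intT_ae f g : measurableT f -> measurableT g -> eqT f g -> intT f = intT g.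
Proof.
move=> [fr fi] [gr gi] E; congr (Complex (_ * _) (_ * _)); congr fine;
 (apply: ae_eq_integral; [by []|exact/measurable_EFinP|exact/measurable_EFinP|]);
 by move: E; rewrite /eqT /aeT; apply: filterS; [exact: (ae_filter_ringOfSetsType mu)|] => t + At => /(_ At) ->.
Qed.

Lemma eqT_sym (V : Type) (f g : C -> V) : eqT f g -> eqT g f.
Proof. by apply: aeTW. Qed.

(** The circle has positive measure: if P failed everywhere, 1 = 0 would hold almost everywhere, and
    integration would give 1 = 0. *)
Lemma aeT_ex (P : C -> Prop) : aeT P -> exists2 z, `|z| = 1 & P z.
Proof.
move=> aP; apply: contrapT => H.
have : @eqT R C (fun=> 1) (fun=> 0).
  by rewrite /eqT; apply: (aeTW _ aP) => z z1 Pz; case: H; exists z.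
move/(intT_ae (measT_cst _) (measT_cst _)); rewrite !intT_cst.
by move/eqP; rewrite oner_eq0.
Qed.

Lemma intT_norm_ge0 f : 0 <= intT (fun z => f z * (f z)^*).
Proof.
rewrite lecE /=; apply/andP; split; last first.
  rewrite mulr_ge0 ?invr_ge0 ?(ltW pi2_gt0) // Rintegral_ge0 // => t _.
  by rewrite normCK_sqn /= sqn_ge0.
under eq_Rintegral => t _ do rewrite normCK_sqn /=.
by rewrite Rintegral_cst // mul0r mulr0.
Qed.

Lemma intT_norm_eq0 f : L2 f -> intT (fun z => f z * (f z)^*) = 0 -> eqT f (fun=> 0).
Proof.
move=> /L2P[mf lf] /(congr1 (@complex.Re R)) /= /eqP.
rewrite mulf_eq0 invr_eq0 gt_eqF ?pi2_gt0 //= => /eqP H.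
have {}H : (\int[mu]_(t in angles) `|(sqn (f (cis t)))%:E| = 0)%E.
  have : \int[mu]_(t in angles) sqn (f (cis t)) = 0.
    by rewrite -{}[RHS]H; apply: eq_Rintegral => t _; rewrite normCK_sqn.
  under eq_integral => t _ do rewrite /= ger0_norm ?sqn_ge0 //.
  move=> H0; rewrite -[RHS]/(0%:E) -H0 /Rintegral fineK //.
  exact: integrable_fin_num.
have mS : measurable_fun angles (fun t => (sqn (f (cis t)))%:E).
  by apply/measurable_EFinP; exact: measT_sqn.
have := (ae_eq_integral_abs mu measurable_angles mS).1 H.
apply: (@filterS _ _ (ae_filter_ringOfSetsType mu)).
by move=> t + At => /(_ At) [] /sqn_eq0.
Qed.

End CircleIntegral.

(** * The Hardy space and the Szego kernel *)

Section Hardy.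
Variable R : realType.
Local Notation C := R[i].
Local Notation mu := (@lebesgue_measure R).
Local Notation angles := (@angles R).
Local Notation intT := (@intT R).
Local Notation measurableT := (@Defs.measurableT R).
Local Notation H2 := (@H2 R).
Local Notation L2 := (@L2 R).
Implicit Types f g h u : C -> C.

Lemma cisX (t : R) m : cis t ^+ m = cis (m%:R * t).
Proof.
elim: m => [|m IH]; first by rewrite mul0r /cis cos0 sin0.
rewrite exprS IH -natr1 mulrDl mul1r addrC /cis cosD sinD.
by apply: complex_ext; rewrite ?cReM ?cImM /= 1?addrC.
Qed.

Lemma FTC_period (F f : R -> R) : (forall t : R, is_derive t (1 : R) F (f t)) ->
  continuous f -> F (2 * pi) = F 0 -> \int[lebesgue_measure]_(t in angles) f t = 0.
Proof.
move=> dF cf FF.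
have H := @continuous_FTC2 R f F 0 (2 * pi) (pi2_gt0 R).
rewrite /Rintegral H ?FF ?subee //.
- exact: continuous_subspaceT.
- split.
  + by move=> x _; have := dF x => -[].
  + apply: cvg_at_right_filter; apply: differentiable_continuous.
    by apply/derivable1_diffP; have := dF 0 => -[].
  + apply: cvg_at_left_filter; apply: differentiable_continuous.
    by apply/derivable1_diffP; have := dF (2 * pi) => -[].
- by move=> x _; rewrite derive1E; have := dF x => -[].
Qed.

Lemma sin2pin m : sin (m%:R * (2 * pi)) = 0 :> R.
Proof.
elim: m => [|m IH]; first by rewrite mul0r sin0.
by rewrite -natr1 mulrDl mul1r [2 * pi]mulr_natl sinD2pi -[pi *+ 2]mulr_natl.
Qed.

Lemma cos2pin m : cos (m%:R * (2 * pi)) = 1 :> R.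
Proof.
elim: m => [|m IH]; first by rewrite mul0r cos0.
by rewrite -natr1 mulrDl mul1r [2 * pi]mulr_natl cosD2pi -[pi *+ 2]mulr_natl.
Qed.

Lemma continuous_cosM (k : R) : continuous (fun t : R => cos (k * t)).
Proof.
by move=> t; apply: continuous_comp; [exact: mulrl_continuous|exact: continuous_cos].
Qed.

Lemma continuous_sinM (k : R) : continuous (fun t : R => sin (k * t)).
Proof.
by move=> t; apply: continuous_comp; [exact: mulrl_continuous|exact: continuous_sin].
Qed.

Lemma intT_expr m : intT (fun z => z ^+ m.+1) = 0.
Proof.
have m0 : m.+1%:R != 0 :> R by rewrite pnatr_eq0.
apply: complex_ext; rewrite /= -[RHS](mulr0 ((2 * pi)^-1)); congr (_ * _).
  under eq_Rintegral => t _ do rewrite cisX /=.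
  apply: (@FTC_period (fun t => m.+1%:R^-1 * sin (m.+1%:R * t))).
  - move=> t; apply: is_derive_eq.
    by rewrite /GRing.scale /=; field.
  - exact: continuous_cosM.
  - by rewrite sin2pin !mulr0 sin0 mulr0.
under eq_Rintegral => t _ do rewrite cisX /=.
apply: (@FTC_period (fun t => - (m.+1%:R^-1 * cos (m.+1%:R * t)))).
- move=> t; apply: is_derive_eq.
  by rewrite /GRing.scale /=; field.
- exact: continuous_sinM.
- by rewrite cos2pin !mulr0 cos0.
Qed.

Lemma bddTX m : bddT (fun z : C => z ^+ m).
Proof.
elim: m => [|m IH]; first by under eq_fun do rewrite expr0; exact: bddT_cst.
by under eq_fun do rewrite exprS; apply: bddTM => //; exact: bddT_id.
Qed.

(** A negative index is [Negz m], that is -(m + 1), so the coefficient is an integral against z ^+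
    m.+1 and integer powers disappear. *)
Lemma H2P f : H2 f <-> L2 f /\ forall m, intT (fun z => f z * z ^+ m.+1) = 0.
Proof.
split=> -[lf H]; split => //; last by case=> // m _; exact: H.
by move=> m; have := H (Negz m) erefl; rewrite /fourier.
Qed.

Lemma H2_L2 f : H2 f -> L2 f.
Proof. by case. Qed.

Lemma H2_congr f g : (forall z, `|z| = 1 -> f z = g z) -> H2 f -> H2 g.
Proof.
move=> E /H2P[lf H]; apply/H2P; split; first exact: L2_congr lf.
by move=> m; rewrite -[RHS](H m); apply: intT_congr => z z1; rewrite E.
Qed.

Lemma H2_cst (c : C) : H2 (fun=> c).
Proof.
apply/H2P; split; first exact: L2_cst.
move=> m; rewrite intTZ ?intT_expr ?mulr0 //.
exact: itg_L2 (L2_bdd (bddTX _)).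
Qed.

Lemma H2D f g : H2 f -> H2 g -> H2 (fun z => f z + g z).
Proof.
move=> /H2P[lf Hf] /H2P[lg Hg]; apply/H2P; split; first exact: L2D.
move=> m; under eq_fun do rewrite mulrDl.
by rewrite intTD ?Hf ?Hg ?addr0 //; apply: itgM => //; apply: L2_bdd; exact: bddTX.
Qed.

Lemma H2Z (c : C) f : H2 f -> H2 (fun z => c * f z).
Proof.
move=> /H2P[lf Hf]; apply/H2P; split; first exact: L2Z.
move=> m; under eq_fun do rewrite -mulrA.
by rewrite intTZ ?Hf ?mulr0 //; apply: itgM => //; apply: L2_bdd; exact: bddTX.
Qed.

Lemma H2N f : H2 f -> H2 (fun z => - f z).
Proof. by move=> /(H2Z (-1)); under eq_fun do rewrite mulN1r. Qed.

Lemma H2B f g : H2 f -> H2 g -> H2 (fun z => f z - g z).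
Proof. by move=> Hf Hg; apply: H2D => //; exact: H2N. Qed.

Lemma H2_zM f : H2 f -> H2 (fun z => z * f z).
Proof.
move=> /H2P[lf Hf]; apply/H2P; split; first exact: L2_bddM (bddT_id R) lf.
by move=> m; under eq_fun do rewrite mulrAC -exprS mulrC; exact: Hf.
Qed.

Lemma H2_zXM m f : H2 f -> H2 (fun z => z ^+ m * f z).
Proof.
move=> Hf; elim: m => [|m IH]; first by under eq_fun do rewrite expr0 mul1r.
by under eq_fun do rewrite exprS -mulrA; exact: H2_zM.
Qed.

Lemma norm_sqn_le (x : C) (M : R) : `|x| <= M%:C%C -> sqn x <= M ^+ 2.
Proof.
move=> H; rewrite -lecR -normCK_sqn -normCK rmorphXn /=.
by rewrite lerXn2r // nnegrE ?normr_ge0 // (le_trans _ H).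
Qed.

Definition szego (a z : C) : C := (1 - a^* * z)^-1.

Lemma szego_den_neq0 (a z : C) : `|a| < 1 -> `|z| <= 1 -> 1 - a^* * z != 0.
Proof.
move=> a1 z1; rewrite subr_eq0; apply/eqP => E.
have : `|a^* * z| < 1; last by rewrite -E normr1 ltxx.
rewrite normrM norm_conjC; apply: (le_lt_trans _ a1).
by rewrite -[leRHS]mulr1 ler_wpM2l.
Qed.

(** One step of the geometric series of the kernel; the recursions for moments and for [ev] use it
    in place of the full expansion. *)
Lemma szegoE (a z : C) : `|a| < 1 -> `|z| = 1 -> szego a z = 1 + a^* * z * szego a z.
Proof.
move=> a1 z1; have := @szego_den_neq0 a z a1; rewrite z1 lexx => /(_ isT) H.
by rewrite /szego; field.
Qed.

Lemma szego_bdd (a : C) : `|a| < 1 -> bddT (szego a).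
Proof.
move=> a1; split.
  apply: measTV; last by move=> z z1; apply: szego_den_neq0 => //; rewrite z1.
  apply: measTD; first exact: measT_cst.
  under eq_fun do rewrite -mulN1r mulrA.
  by apply: measTZ; exact: measT_id.
have r1 : ComplexField.Normc.normc a < 1 by rewrite -ltcR -normr_normc.
exists ((1 - ComplexField.Normc.normc a)^-1 ^+ 2) => z z1; apply: norm_sqn_le.
rewrite fmorphV rmorphB /= -normr_normc normfV lef_pV2 ?posrE ?subr_gt0 //; last first.
  by rewrite normr_gt0 szego_den_neq0 // z1.
apply: le_trans (lerB_normD _ _) ; rewrite normrN normr1 normrM norm_conjC z1 mulr1.
by [].
Qed.

(** Since |z^m| = 1, the real and imaginary parts of g z^m are dominated by |g|^2 + 1 for every m;
    [W] is the mean of this function. *)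
Lemma intT_shift_bound g : L2 g ->
  exists K : R, forall m, sqn (intT (fun z => g z * z ^+ m)) <= K.
Proof.
move=> lg; have /L2P[mg ig] := lg.
pose W := (2 * pi)^-1 * \int[mu]_(t in angles) (sqn (g (cis t)) + 1).
have iW : mu.-integrable angles (EFin \o (fun t => sqn (g (cis t)) + 1)).
  apply: integrableRD => //; have /itg_L2[+ _] := L2_cst (1 : C).
  by apply: eq_integrable => //; exact: measurable_angles.
have Hn m t : sqn (cis t ^+ m) = 1 :> R.
  by apply: norm1_sqn; rewrite normrX norm_cis expr1n.
exists (W ^+ 2 + W ^+ 2) => m.
have [ir ii] := itgM lg (L2_bdd (bddTX m)).
have ma := @measurable_angles R.
have pi0 : 0 <= (2 * pi)^-1 :> R by rewrite invr_ge0 ltW ?pi2_gt0.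
have Hb (v : R -> R) : mu.-integrable angles (EFin \o v) ->
    (forall t, `|v t| <= sqn (g (cis t)) + 1) ->
    ((2 * pi)^-1 * \int[mu]_(t in angles) v t) ^+ 2 <= W ^+ 2.
  move=> iv Hv; rewrite -real_normK ?num_real //.
  have W0 : 0 <= W.
    by apply: mulr_ge0 => //; apply: Rintegral_ge0 => t _; rewrite addr_ge0 ?sqn_ge0.
  rewrite lerXn2r ?nnegrE ?normr_ge0 // normrM [`|_^-1|]ger0_norm // ler_wpM2l //.
  apply: le_trans (le_normr_Rintegral _ _) _ => //.
  by apply: le_Rintegral => //; exact: (integrable_norm iv).
by apply: lerD; apply: Hb => // t; rewrite -(Hn m t); [exact: normr_ReM_le|exact: normr_ImM_le].
Qed.

Lemma geometric_le0 (x q K : R) : 0 <= q -> q < 1 ->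
  (forall j, x <= q ^+ j * K) -> x <= 0.
Proof.
move=> q0 q1 H.
have : (fun j => K * q ^+ j) @ \oo --> (0 : R).
  by apply: cvg_geometric; rewrite ger0_norm.
move=> /cvg_lim <- //; apply: limr_ge.
  by apply/cvg_ex; exists 0; apply: cvg_geometric; rewrite ger0_norm.
by apply: nearW => j; rewrite mulrC.
Qed.

(* The moments J_m of f * szego a satisfy J_m = a^* J_(m+1) and are bounded, hence vanish. *)
Lemma H2_szego (a : C) f : `|a| < 1 -> H2 f -> H2 (fun z => szego a z * f z).
Proof.
move=> a1 /H2P[lf Hf]; have lg := L2_bddM (szego_bdd a1) lf.
apply/H2P; split => // m.
have [K HK] := intT_shift_bound lg.
pose J m := intT (fun z => szego a z * f z * z ^+ m.+1).
have JS k : J k = a^* * J k.+1.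
  rewrite /J -[LHS]addr0 -[X in _ + X]oppr0 -(Hf k) -intTZ; last first.
    by apply: itgM => //; apply: L2_bdd; exact: bddTX.
  rewrite -intTB; first last.
  - by apply: itgM => //; apply: L2_bdd; exact: bddTX.
  - by apply: itgM => //; apply: L2_bdd; exact: bddTX.
  apply: intT_congr => z z1; rewrite [in LHS](szegoE a1 z1) [z ^+ k.+2]exprS.
  by ring.
have qa : sqn a^* < 1.
  rewrite -ltcR -normCK_sqn -normCK norm_conjC expr_lt1 //.
have Jj j : sqn (J m) = sqn a^* ^+ j * sqn (J (m + j)%N).
  elim: j => [|j ->]; first by rewrite addn0 mul1r.
  by rewrite (JS (m + j)%N) sqnM exprSr mulrA addnS.
apply: sqn_eq0; apply/eqP; rewrite eq_le sqn_ge0 andbT.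
apply: (@geometric_le0 _ (sqn a^*) K) => //; first exact: sqn_ge0.
by move=> j; rewrite -/(J m) (Jj j) ler_wpM2l ?HK // exprn_ge0 ?sqn_ge0.
Qed.

(* Point evaluation at a: for a in the disk, f(a) = <f, szego a>. *)
Definition ev (a : C) f : C := intT (fun z => f z * (szego a z)^*).

Lemma itg_ev (a : C) f : `|a| < 1 -> L2 f -> itg (fun z => f z * (szego a z)^*).
Proof. by move=> a1 lf; apply: itgM => //; apply: L2_bdd; apply: bddTJ; exact: szego_bdd. Qed.

Lemma ev_congr (a : C) f g : (forall z, `|z| = 1 -> f z = g z) -> ev a f = ev a g.
Proof. by move=> E; apply: intT_congr => z z1; rewrite E. Qed.

Lemma evD (a : C) f g : `|a| < 1 -> L2 f -> L2 g -> ev a (fun z => f z + g z) = ev a f + ev a g.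
Proof.
move=> a1 lf lg; rewrite /ev -intTD; try exact: itg_ev.
by apply: intT_congr => z _; rewrite mulrDl.
Qed.

Lemma evZ (a c : C) f : `|a| < 1 -> L2 f -> ev a (fun z => c * f z) = c * ev a f.
Proof.
move=> a1 lf; rewrite /ev -intTZ; try exact: itg_ev.
by apply: intT_congr => z _; rewrite mulrA.
Qed.

(** Conjugating [szegoE] splits z f conj k_a into z f, whose mean vanishes for f in H2, and a f conj
    k_a. *)
Lemma ev_zM (a : C) f : `|a| < 1 -> H2 f -> ev a (fun z => z * f z) = a * ev a f.
Proof.
move=> a1 /H2P[lf Hf].
have i1 := itg_ev a1 lf.
have i2 : itg (fun z => f z * z ^+ 1) by apply: itgM => //; apply: L2_bdd; exact: bddTX.
rewrite /ev -[RHS]add0r -(Hf 0%N) -intTZ // -intTD //; last exact: itgZ.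
apply: intT_congr => z z1; have := congr1 Num.conj (szegoE a1 z1).
rewrite rmorphD rmorph1 !rmorphM /= conjCK => E.
rewrite {1}E expr1 !mulrDr mulr1 mulrC; congr (_ + _).
transitivity (z * z^* * (a * (f z * (szego a z)^*))); first by ring.
by rewrite norm1_mulJ // mul1r.
Qed.

Lemma ev_zXM (a : C) m f : `|a| < 1 -> H2 f -> ev a (fun z => z ^+ m * f z) = a ^+ m * ev a f.
Proof.
move=> a1 Hf; elim: m => [|m IH].
  by under eq_fun do rewrite expr0 mul1r; rewrite expr0 mul1r.
under eq_fun do rewrite exprS -mulrA.
by rewrite ev_zM // ?IH ?exprS ?mulrA //; exact: H2_zXM.
Qed.

Lemma ev_1 (a : C) : `|a| < 1 -> ev a (fun=> 1) = 1.
Proof.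
move=> a1; rewrite /ev; under eq_fun do rewrite mul1r.
have ls := L2_bdd (szego_bdd a1).
rewrite intTJ; last exact: itg_L2.
(* By [szegoE] the kernel is 1 plus a multiple of z k_a, and z k_a has mean zero because k_a is in
   H2. *)
have -> : intT (szego a) = 1; last by rewrite rmorph1.
have /H2P[_ /(_ 0%N) H] := H2_szego a1 (H2_cst 1).
have i1 : itg (fun z => szego a z * 1 * z ^+ 1).
  by apply: itgM; [apply: L2_bdd; apply: bddTM; [exact: szego_bdd|exact: bddT_cst]|apply: L2_bdd; exact: bddTX].
rewrite -[RHS](intT_cst 1) -[RHS]addr0 -(mulr0 a^*) -H -intTZ // -intTD //; first last.
- exact: itgZ.
- exact: itg_L2 (L2_cst _).
by apply: intT_congr => z z1; rewrite {1}(szegoE a1 z1); ring.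
Qed.

Lemma ev_lin (a b c : C) f : `|a| < 1 -> H2 f ->
  ev a (fun z => (b + c * z) * f z) = (b + c * a) * ev a f.
Proof.
move=> a1 Hf.
under eq_fun do rewrite mulrDl -mulrA.
have lf := H2_L2 Hf; have lzf := H2_L2 (H2_zM Hf).
by rewrite evD ?evZ ?ev_zM ?mulrDl ?mulrA //; exact: L2Z.
Qed.

(** Multiplying k_b f by 1 - conj b z gives back f, so [ev_lin] determines the value of k_b f at
    a. *)
Lemma ev_szego (a b : C) f : `|a| < 1 -> `|b| < 1 -> H2 f ->
  ev a (fun z => szego b z * f z) = szego b a * ev a f.
Proof.
move=> a1 b1 Hf; have Hs := H2_szego b1 Hf.
have d0 : 1 - b^* * a != 0 by apply: szego_den_neq0 => //; exact: ltW.
have := ev_lin 1 (- b^*) a1 Hs; rewrite mulNr.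
rewrite (@ev_congr _ _ f); last first.
  move=> z z1; rewrite mulNr mulrA /szego mulfV ?mul1r //.
  by apply: szego_den_neq0 => //; rewrite z1.
by move=> ->; rewrite mulrA /szego mulVf // mul1r.
Qed.

Definition blf (a z : C) : C := (z - a) / (1 - a^* * z).

Lemma norm_blf (a z : C) : `|a| < 1 -> `|z| = 1 -> `|blf a z| = 1.
Proof.
move=> a1 z1; have d0 : 1 - a^* * z != 0 by apply: szego_den_neq0 => //; rewrite z1.
have zz := norm1_mulJ z1.
suff : `|z - a| = `|1 - a^* * z| by rewrite normrM normfV => ->; rewrite divff ?normr_eq0.
apply/eqP; rewrite -(@eqrXn2 _ 2) //; rewrite !normCK; apply/eqP.
rewrite !rmorphB !rmorphM rmorph1 /= conjCK.
transitivity (z * z^* - z * a^* - a * z^* + a * a^*); first by ring.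
transitivity (1 - z * a^* - a * z^* + a * a^* * (z * z^*)); last by ring.
by rewrite zz mulr1.
Qed.

Lemma measurable_blf (a : C) : `|a| < 1 -> measurableT (blf a).
Proof.
move=> a1; apply: measTM; last by have [] := szego_bdd a1.
by apply: measTD; [exact: measT_id|exact: measT_cst].
Qed.

Lemma blfE (a z : C) : blf a z = (- a + 1 * z) * szego a z.
Proof. by rewrite /blf mul1r addrC. Qed.

Lemma H2_lin (b c : C) f : H2 f -> H2 (fun z => (b + c * z) * f z).
Proof.
move=> Hf; under eq_fun do rewrite mulrDl -mulrA.
by apply: H2D; apply: H2Z => //; exact: H2_zM.
Qed.

Lemma H2_blf (a : C) f : `|a| < 1 -> H2 f -> H2 (fun z => blf a z * f z).
Proof.
move=> a1 Hf; under eq_fun do rewrite blfE -mulrA.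
by apply: H2_lin; exact: H2_szego.
Qed.

Lemma ev_blf (a b : C) f : `|a| < 1 -> `|b| < 1 -> H2 f ->
  ev a (fun z => blf b z * f z) = blf b a * ev a f.
Proof.
move=> a1 b1 Hf; under eq_fun do rewrite blfE -mulrA.
by rewrite ev_lin ?ev_szego // 1?mulrA ?blfE //; exact: H2_szego.
Qed.

(* g is a representative of the orthogonal projection of u onto H^2. *)
Definition hproj u g := [/\ L2 u, H2 g & forall k, H2 k -> intT (fun z => (u z - g z) * (k z)^*) = 0].

Lemma hproj_congr u v g : (forall z, `|z| = 1 -> u z = v z) -> hproj u g -> hproj v g.
Proof.
move=> E [lu Hg H]; split => //; first exact: L2_congr lu.
by move=> k Hk; rewrite -[RHS](H k Hk); apply: intT_congr => z z1; rewrite E.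
Qed.

Lemma itg_hproj u g k : L2 u -> H2 g -> H2 k -> itg (fun z => (u z - g z) * (k z)^*).
Proof. by move=> lu Hg Hk; apply: itgM; [apply: L2B => //; exact: H2_L2|apply: L2J; exact: H2_L2]. Qed.

Lemma hprojD u v g h : hproj u g -> hproj v h -> hproj (fun z => u z + v z) (fun z => g z + h z).
Proof.
move=> [lu Hg H] [lv Hh K]; split; [exact: L2D|exact: H2D|] => k Hk.
rewrite -[RHS]addr0 -{1}(H k Hk) -(K k Hk) -intTD; try exact: itg_hproj.
by apply: intT_congr => z z1; ring.
Qed.

Lemma hprojZ (c : C) u g : hproj u g -> hproj (fun z => c * u z) (fun z => c * g z).
Proof.
move=> [lu Hg H]; split; [exact: L2Z|exact: H2Z|] => k Hk.
rewrite -[RHS](mulr0 c) -(H k Hk) -intTZ; try exact: itg_hproj.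
by apply: intT_congr => z z1; ring.
Qed.

Lemma hproj_H2 u : H2 u -> hproj u u.
Proof.
move=> Hu; split => //; first exact: H2_L2.
by move=> k Hk; under eq_fun do rewrite subrr mul0r; exact: intT_cst.
Qed.

(** L2 v is assumed because equality almost everywhere does not transfer measurability. *)
Lemma hproj_ae u v g : eqT u v -> L2 v -> hproj u g -> hproj v g.
Proof.
move=> E lv [lu Hg H]; split => // k Hk; rewrite -[RHS](H k Hk).
apply: intT_ae; [exact: itg_measurable (itg_hproj lv Hg Hk)|exact: itg_measurable (itg_hproj lu Hg Hk)|].
by apply: (aeTW _ E) => z _ /= ->.
Qed.

Lemma hproj_inj u g h : hproj u g -> hproj u h -> eqT g h.
Proof.
move=> [lu Hg H] [_ Hh K]; have Hd := H2B Hg Hh.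
have H0 : intT (fun z => (g z - h z) * (g z - h z)^*) = 0.
  rewrite -[RHS]subr0 -{1}(K _ Hd) -(H _ Hd) -intTB; try exact: itg_hproj.
  by apply: intT_congr => z _; rewrite -mulrBl; congr (_ * _); ring.
have := intT_norm_eq0 (H2_L2 Hd) H0.
by apply: aeTW => z _ /eqP; rewrite subr_eq0 => /eqP.
Qed.

Definition has_hproj u := exists g, hproj u g.

Lemma hproj_blfJ (a : C) f : `|a| < 1 -> H2 f -> has_hproj (fun z => (blf a z)^* * f z).
Proof.
move=> a1 Hf.
(* This is f(a) / k_a(a), as k_a(a) = 1 / (1 - |a|^2). *)
pose c := ev a f * (1 - a^* * a).
pose f' z := f z - c * szego a z.
have bs := szego_bdd a1.
have Hs : H2 (szego a).
  by apply: H2_congr (H2_szego a1 (H2_cst 1)) => z _; rewrite mulr1.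
have Hf' : H2 f' by apply: H2B => //; exact: H2Z.
have bb : bddT (blf a).
  by apply: bddT_unimodular => [|z z1]; [exact: measurable_blf|exact: norm_blf].
have d0 : 1 - a^* * a != 0 by apply: szego_den_neq0 => //; exact: ltW.
have es : ev a (szego a) = szego a a.
  rewrite -[RHS]mulr1 -(ev_1 a1) -ev_szego //; last exact: H2_cst.
  by apply: ev_congr => z _; rewrite mulr1.
have E0 : ev a f' = 0.
  rewrite /f'; under eq_fun do rewrite -mulNr.
  have ls := H2_L2 Hs.
  rewrite evD ?evZ ?es //; [|exact: H2_L2|exact: L2Z].
  by rewrite /c /szego; field.
exists (fun z => (blf a z)^* * f' z); split.
- by apply: L2_bddM; [exact: bddTJ|exact: H2_L2].
- apply/H2P; split; first by apply: L2_bddM; [exact: bddTJ|exact: H2_L2].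
  (* On the circle z^(m+1) conj b_a = (1 - conj a z) z^m conj k_a, so this moment is the value at a
     of (1 - conj a z) z^m f', which is zero with f'(a). *)
  move=> m; have Hz := H2_zXM m Hf'.
  have := ev_lin 1 (- a^*) a1 Hz; rewrite ev_zXM // E0 !mulr0 => <-.
  apply: intT_congr => z z1; rewrite blfE rmorphM rmorphD rmorphN mul1r /= exprS.
  transitivity ((z * z^* - a^* * z) * (z ^+ m * f' z) * (szego a z)^*); first by ring.
  by rewrite norm1_mulJ // mulNr.
(* The error is c conj b_a k_a. Its pairing with k is c times the conjugate of the value of b_a k at
   a, and b_a(a) = 0. *)
- move=> k Hk; have ib : itg (fun z => blf a z * k z * (szego a z)^*).
    by apply: itg_ev => //; exact: H2_L2 (H2_blf a1 Hk).
  transitivity (intT (fun z => c * (blf a z * k z * (szego a z)^*)^*)).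
    apply: intT_congr => z z1; rewrite /f' !rmorphM /= conjCK; ring.
  rewrite intTZ ?intTJ //.
    rewrite -/(ev a (fun z => blf a z * k z)) ev_blf // /blf subrr !mul0r.
    by rewrite rmorph0 mulr0.
  exact: itgJ.
Qed.

End Hardy.

(** * Finite Blaschke products *)

Section Blaschke.
Variable R : realType.
Local Notation C := R[i].
Local Notation intT := (@intT R).
Local Notation measurableT := (@Defs.measurableT R).
Local Notation H2 := (@H2 R).
Implicit Types f g h u v : C -> C.

(* All that is used of a finite Blaschke product, in a form closed under products. *)
Definition tractable u := [/\ measurableT u, forall z, `|z| = 1 -> `|u z| = 1,
  forall f, H2 f -> H2 (fun z => u z * f z),
  forall f, H2 f -> has_hproj (fun z => (u z)^* * f z) &
  forall f, H2 f -> intT (fun z => u z * f z) = u 0 * intT f].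

Lemma tractable_bdd u : tractable u -> bddT u.
Proof. by case=> m n _ _ _; exact: bddT_unimodular. Qed.

(** Agreement is required on the closed disk, not only on the circle, because the last clause of
    [tractable] evaluates u at 0. *)
Lemma tractable_congr u v : (forall z, `|z| <= 1 -> u z = v z) -> tractable u -> tractable v.
Proof.
move=> E0 [m n Hu Pu Iu].
have E z : `|z| = 1 -> u z = v z by move=> z1; apply: E0; rewrite z1.
split.
- exact: measT_congr m.
- by move=> z z1; rewrite -E // n.
- by move=> f /Hu; apply: H2_congr => z z1; rewrite E.
- by move=> f /Pu[g Hg]; exists g; apply: hproj_congr Hg => z z1; rewrite E.
- move=> f Hf; rewrite -E0 ?normr0 // -Iu //.
  by apply: intT_congr => z z1; rewrite E.
Qed.

Lemma tractable_cst (c : C) : `|c| = 1 -> tractable (fun=> c).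
Proof.
move=> c1; split; [exact: measT_cst|by []|..].
- by move=> f Hf; exact: H2Z.
- by move=> f Hf; exists (fun z => c^* * f z); apply: hproj_H2; exact: H2Z.
- by move=> f Hf; rewrite intTZ //; apply: itg_L2; exact: H2_L2.
Qed.

(** Multiplication by u preserves H2, so multiplication by conj u preserves the orthogonal
    complement of H2; hence projecting after conj v and again after conj u loses nothing. *)
Lemma hproj_mul u v f g h : tractable u -> hproj (fun z => (v z)^* * f z) g ->
  hproj (fun z => (u z)^* * g z) h -> hproj (fun z => (u z * v z)^* * f z) h.
Proof.
move=> tu [l1 Hg H] [l2 Hh K]; have bu := tractable_bdd tu.
have E z : (u z * v z)^* * f z = (u z)^* * ((v z)^* * f z).
  by rewrite rmorphM mulrA.
split => //.
  by apply: L2_congr (L2_bddM (bddTJ bu) l1) => z _; rewrite E.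
move=> k Hk; have Huk : H2 (fun z => u z * k z) by case: tu => _ _ + _ _; apply.
rewrite -[RHS]addr0 -{1}(H _ Huk) -(K _ Hk) -intTD; try exact: itg_hproj.
by apply: intT_congr => z _; rewrite E !rmorphM /=; ring.
Qed.

Lemma tractableM u v : tractable u -> tractable v -> tractable (fun z => u z * v z).
Proof.
move=> tu tv; have [m n Hu Pu Iu] := tu; have [m' n' Hv Pv Iv] := tv; split.
- exact: measTM.
- by move=> z z1; rewrite normrM n // n' // mulr1.
- by move=> f Hf; under eq_fun do rewrite -mulrA; apply: Hu; exact: Hv.
- move=> f /Pv[g Hg]; have [_ Hg2 _] := Hg; have [h Hh] := Pu _ Hg2.
  by exists h; exact: hproj_mul Hg Hh.
- move=> f Hf; under eq_fun do rewrite -mulrA.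
  by rewrite Iu ?Iv ?mulrA //; exact: Hv.
Qed.

Lemma ev0 f : ev 0 f = intT f.
Proof.
by apply: intT_congr => z _; rewrite /szego rmorph0 mul0r subr0 invr1 rmorph1 mulr1.
Qed.

Lemma tractable_blf (a : C) : `|a| < 1 -> tractable (blf a).
Proof.
move=> a1; split.
- exact: measurable_blf.
- by move=> z; exact: norm_blf.
- by move=> f; exact: H2_blf.
- by move=> f; exact: hproj_blfJ.
- by move=> f Hf; rewrite -!ev0 ev_blf // normr0.
Qed.

Definition blprod (c : C) (s : seq C) (z : C) : C := c * \prod_(a <- s) blf a z.

Lemma tractable_blprod (c : C) s : `|c| = 1 -> all (fun a => `|a| < 1) s ->
  tractable (blprod c s).
Proof.
move=> c1; elim: s => [|a s IH] /= => [_|/andP[a1 /IH ts]].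
  by apply: tractable_congr (tractable_cst c1) => z _; rewrite /blprod big_nil mulr1.
apply: tractable_congr (tractableM (tractable_blf a1) ts) => z _.
by rewrite /blprod big_cons; ring.
Qed.

Lemma tractable_blaschke th : finite_blaschke th -> tractable th.
Proof.
move=> [c [s [c1 s1 E]]]; apply: tractable_congr (tractable_blprod c1 s1) => z z1.
by rewrite E.
Qed.

(** A nonconstant product has at least one factor, and a is the zero of the first. The conclusion
    says that th H2 is orthogonal to k_a. *)
Lemma blaschke_zero th : finite_blaschke th -> nonconstant th ->
  exists2 a : C, `|a| < 1 & forall f, H2 f -> ev a (fun z => th z * f z) = 0.
Proof.
move=> [c [s [c1 s1 E]]] nc; case: s => [|a s] /= in s1 E.
  by case: nc; exists c => z /E ->; rewrite big_nil mulr1.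
have /andP[a1 {}s1] := s1; exists a => // f Hf.
have [_ _ Hu _ _] := tractable_blprod c1 s1.
rewrite (@ev_congr _ _ _ (fun z => blf a z * (blprod c s z * f z))).
  by rewrite ev_blf //; [rewrite /blf subrr !mul0r|exact: Hu].
by move=> z z1; rewrite E ?z1 // big_cons /blprod /blf; ring.
Qed.

End Blaschke.

(** * Uniqueness of Fourier coefficients *)

Section FourierUniqueness.
Variable R : realType.
Local Notation C := R[i].
Local Notation mu := (@lebesgue_measure R).
Local Notation angles := (@angles R).
Local Notation intT := (@intT R).
Implicit Types f g h u : C -> C.

(* Composed with [arc x] below, these give trigonometric polynomials with values in
   [0, 1] that converge to the indicator function of the arc from 0 to x. *)
Definition kuhn (n : nat) (x : R) : R := (1 - x ^+ n) ^+ (2 ^ n).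

Lemma kuhn_01 n x : 0 <= x <= 1 -> 0 <= kuhn n x <= 1.
Proof.
move=> /andP[x0 x1]; have y1 : x ^+ n <= 1 by exact: exprn_ile1.
have y0 : 0 <= x ^+ n by exact: exprn_ge0.
by rewrite exprn_ge0 ?subr_ge0 //= exprn_ile1 ?subr_ge0 // lerBlDr lerDl.
Qed.

(** Used with N = 2^n and y = x^n, where N y = (2 x)^n tends to 0 for x < 1/2 and to infinity for x
    > 1/2; this puts the jump of the limit of [kuhn] at 1/2. *)
Lemma bernoulli_lower N (y : R) : 0 <= y <= 1 -> 1 - N%:R * y <= (1 - y) ^+ N.
Proof.
move=> /andP[y0 y1]; elim: N => [|N IH]; first by rewrite mul0r subr0.
rewrite exprS -natr1; have N0 : 0 <= N%:R :> R := ler0n _ _.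
have : (1 - y) * (1 - N%:R * y) <= (1 - y) * (1 - y) ^+ N by rewrite ler_wpM2l // subr_ge0.
apply: le_trans.
have : 0 <= N%:R * (y * y) by rewrite !mulr_ge0.
by move: (N%:R : R) => M; nra.
Qed.

(** The bound (1 - y)^N <= 1 / (1 + N y), multiplied out so that the induction step is the
    polynomial inequality (1 - y) (1 + (N + 1) y) <= 1 + N y. *)
Lemma bernoulli_upper N (y : R) : 0 <= y <= 1 -> (1 - y) ^+ N * (1 + N%:R * y) <= 1.
Proof.
move=> /andP[y0 y1]; elim: N => [|N IH]; first by rewrite mul0r addr0 mulr1.
apply: le_trans IH; rewrite exprS -natr1 -mulrA mulrCA.
apply: ler_wpM2l; first by rewrite exprn_ge0 // subr_ge0.
have N0 : 0 <= N%:R :> R := ler0n _ _.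
have : 0 <= N%:R * (y * y) by rewrite !mulr_ge0.
have : 0 <= y * y by rewrite mulr_ge0.
by move: (N%:R : R) => M; nra.
Qed.

Lemma kuhn_lt (x : R) : 0 <= x -> x < 2^-1 -> kuhn ^~ x @ \oo --> (1 : R).
Proof.
move=> x0 x2; have x1 : x <= 1 by lra.
apply: (@squeeze_cvgr _ _ _ _ (fun n => 1 - (2 * x) ^+ n) (fun=> 1)).
- apply: nearW => n; have /andP[_ ->] := @kuhn_01 n x (introT andP (conj x0 x1)).
  rewrite andbT exprMn -natrX; apply: bernoulli_lower.
  by rewrite exprn_ge0 // exprn_ile1.
- rewrite -[X in _ --> X]subr0; apply: cvgB; first exact: cvg_cst.
  by apply: cvg_expr; rewrite ger0_norm; lra.
- exact: cvg_cst.
Qed.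

Lemma kuhn_gt (x : R) : 2^-1 < x -> x <= 1 -> kuhn ^~ x @ \oo --> (0 : R).
Proof.
move=> x2 x1; have x0 : 0 < x by lra.
have x01 : 0 <= x <= 1 by rewrite (ltW x0) x1.
apply: (@squeeze_cvgr _ _ _ _ (fun=> 0) (fun n => ((2 * x)^-1) ^+ n)).
- apply: nearW => n; have /andP[-> _] /= := kuhn_01 n x01.
  have P : 0 < (2 * x) ^+ n by rewrite exprn_gt0 // mulr_gt0.
  rewrite exprVn -[leRHS]mul1r ler_pdivlMr //.
  have y01 : 0 <= x ^+ n <= 1 by rewrite exprn_ge0 ?exprn_ile1 // ltW.
  apply: le_trans (bernoulli_upper (2 ^ n) y01).
  rewrite ler_wpM2l //; first by have /andP[] := kuhn_01 n x01.
  by rewrite exprMn natrX lerDr.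
- exact: cvg_cst.
- apply: cvg_expr; rewrite ger0_norm; last by rewrite invr_ge0; lra.
  by rewrite invf_lt1; lra.
Qed.

Lemma ae_imp (P Q : R -> Prop) : (forall t, P t -> Q t) ->
  {ae mu, forall t, P t} -> {ae mu, forall t, Q t}.
Proof. by move=> H; apply: filterS; [exact: (ae_filter_ringOfSetsType mu)|exact: H]. Qed.

Lemma ae_and (P Q : R -> Prop) : {ae mu, forall t, P t} ->
  {ae mu, forall t, Q t} -> {ae mu, forall t, P t /\ Q t}.
Proof. by apply: filterS2; [exact: (ae_filter_ringOfSetsType mu)|] => t Pt Qt. Qed.

Lemma ae_neq (x : R) : {ae mu, forall t, t != x}.
Proof.
exists [set x]; split; first exact: measurable_set1.
  exact: lebesgue_measure_set1.
by move=> t /= /negP; rewrite negbK => /eqP.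
Qed.

(** Pairs of exponents, rather than one integer exponent, make this condition stable under
    multiplication by z and by conj z without case analysis. *)
Definition annihilates g :=
  forall p q, intT (fun z => g z * (z ^+ p * (z^*) ^+ q)) = 0.

Definition trig1 (a b z : C) : C := a + b * z + b^* * z^*.

Lemma bddT_conjX q : bddT (fun z : C => (z^*) ^+ q).
Proof.
by apply: bddT_congr (bddTJ (bddTX R q)) => z _; rewrite rmorphXn.
Qed.

Lemma bddT_monomial p q : bddT (fun z : C => z ^+ p * (z^*) ^+ q).
Proof. by apply: bddTM; [exact: bddTX|exact: bddT_conjX]. Qed.

Lemma bddT_trig1 (a b : C) : bddT (trig1 a b).
Proof.
apply: bddTD; last by apply: bddTM; [exact: bddT_cst|exact: bddTJ (bddT_id R)].
by apply: bddTD; [exact: bddT_cst|apply: bddTM; [exact: bddT_cst|exact: bddT_id]].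
Qed.

Lemma itg_bddMr u g : bddT u -> itg g -> itg (fun z => g z * u z).
Proof. by move=> bu ig; under eq_fun do rewrite mulrC; exact: itg_bddM. Qed.

Lemma annihilates_trig1 (a b : C) g : itg g -> annihilates g ->
  annihilates (fun z => trig1 a b z * g z).
Proof.
move=> ig H p q.
have i p' q' := itg_bddMr (bddT_monomial p' q') ig.
transitivity (intT (fun z => a * (g z * (z ^+ p * (z^*) ^+ q)) +
   b * (g z * (z ^+ p.+1 * (z^*) ^+ q)) + b^* * (g z * (z ^+ p * (z^*) ^+ q.+1)))).
  by apply: intT_congr => z _; rewrite /trig1 !exprS; ring.
by rewrite !intTD ?intTZ ?H ?mulr0 ?addr0 //; try apply: itgD; apply: itgZ.
Qed.

Lemma annihilates_B g h : itg g -> itg h -> annihilates g -> annihilates h ->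
  annihilates (fun z => g z - h z).
Proof.
move=> ig ih Hg Hh p q; under eq_fun do rewrite mulrBl.
by rewrite intTB ?Hg ?Hh ?subr0 //; apply: itg_bddMr => //; exact: bddT_monomial.
Qed.

Lemma annihilates_iter (x : C -> C) g :
  bddT x -> (forall h, itg h -> annihilates h -> annihilates (fun z => x z * h z)) ->
  forall n, itg g -> annihilates g ->
  itg (fun z => x z ^+ n * g z) /\ annihilates (fun z => x z ^+ n * g z).
Proof.
move=> bx H n ig Hg; elim: n => [|n [i1 IH]].
  by split; [apply: itg_congr ig => z _; rewrite mul1r|under eq_fun do rewrite mul1r].
have E : (fun z => x z ^+ n.+1 * g z) = (fun z => x z * (x z ^+ n * g z)).
  by apply/funext => z; rewrite exprS mulrA.
by rewrite E; split; [exact: itg_bddM|exact: H].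
Qed.

Lemma bddT_X u n : bddT u -> bddT (fun z => u z ^+ n).
Proof.
move=> bu; elim: n => [|n IH]; first by under eq_fun do rewrite expr0; exact: bddT_cst.
by under eq_fun do rewrite exprS; exact: bddTM.
Qed.

Lemma bddT_1BX (u : C -> C) n : bddT u -> bddT (fun z => 1 - u z ^+ n).
Proof.
move=> bu; apply: bddTD; first exact: bddT_cst.
by under eq_fun do rewrite -mulN1r; apply: bddTM; [exact: bddT_cst|exact: bddT_X].
Qed.

(** The nested powers of [kuhn] are two nested uses of [annihilates_iter], for [trig1] and for 1 -
    trig1^n; the claim is then the case p = q = 0. *)
Lemma annihilates_kuhn (a b : C) g n : itg g -> annihilates g ->
  intT (fun z => (1 - trig1 a b z ^+ n) ^+ (2 ^ n) * g z) = 0.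
Proof.
move=> ig Hg; have bx := bddT_trig1 a b.
have [] := @annihilates_iter (fun z => 1 - trig1 a b z ^+ n) g _ _ (2 ^ n) ig Hg.
- exact: bddT_1BX.
- move=> h ih Hh.
  have [i1 H1] := annihilates_iter bx (@annihilates_trig1 a b) n ih Hh.
  under eq_fun do rewrite mulrBl mul1r.
  exact: annihilates_B.
- by move=> _ /(_ 0%N 0%N); under eq_fun do rewrite !expr0 !mulr1.
Qed.

(** A trigonometric polynomial of degree one in t, scaled into [0, 1]. For x in (0, 2 pi) and t in
    (0, 2 pi), cos (t - x / 2) exceeds cos (x / 2) exactly when t < x, so that [arc] is below 1/2
    exactly there. *)
Definition arc (x t : R) : R := 2^-1 - (cos (t - x / 2) - cos (x / 2)) / 4.

Lemma trig1_arc (x t : R) :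
  trig1 (2^-1 + cos (x / 2) / 4)%:C%C (Complex (- cos (x / 2) / 8) (sin (x / 2) / 8)) (cis t)
  = (arc x t)%:C%C.
Proof.
rewrite /arc cosB.
apply: complex_ext; rewrite /trig1 ?cReD ?cImD ?cReM ?cImM ?cRe_conj ?cIm_conj /=; field; by [].
Qed.

Lemma arc_01 x t : 0 <= arc x t <= 1.
Proof.
rewrite /arc; have := cos_le1 (t - x / 2); have := cos_geN1 (t - x / 2).
have := cos_le1 (x / 2); have := cos_geN1 (x / 2).
by move=> *; apply/andP; split; lra.
Qed.

(** In product form the sign of [arc] - 1/2 can be read off, since sin is positive on (0, pi). *)
Lemma arcE x t : arc x t = 2^-1 - sin (t / 2) * sin ((x - t) / 2) / 2.
Proof.
have E1 : t - x / 2 = t / 2 - (x - t) / 2 by field.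
have E2 : x / 2 = t / 2 + (x - t) / 2 by field.
rewrite /arc E1 [in cos (x / 2)]E2 cosB cosD; field; by [].
Qed.

Lemma kuhn_arc x t : 0 < x < 2 * pi -> 0 < t < 2 * pi -> t != x ->
  kuhn ^~ (arc x t) @ \oo --> (if t < x then 1 else 0 : R).
Proof.
move=> /andP[x0 x2] /andP[t0 t2] tx.
have /andP[a0 a1] := arc_01 x t.
have s1 : 0 < sin (t / 2) by apply: sin_gt0_pi; apply/andP; split; lra.
case: (ltrgtP t x) tx => // ltx _.
  apply: kuhn_lt => //; rewrite arcE.
  have : 0 < sin ((x - t) / 2) by apply: sin_gt0_pi; apply/andP; split; lra.
  by move=> s2; have := mulr_gt0 s1 s2; lra.
apply: kuhn_gt => //; rewrite arcE.
have : 0 < sin ((t - x) / 2) by apply: sin_gt0_pi; apply/andP; split; lra.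
rewrite (_ : (x - t) / 2 = - ((t - x) / 2)); last by field.
by rewrite sinN; move=> s2; have := mulr_gt0 s1 s2; lra.
Qed.

Lemma measurable_kuhn_arc n x : measurable_fun angles (fun t => kuhn n (arc x t)).
Proof.
apply: measurable_funTS; apply: continuous_measurable_fun => t.
rewrite /kuhn /arc.
have c1 : {for t, continuous (fun t => cos (t - x / 2))}.
  apply: continuous_comp; last exact: continuous_cos.
  by apply: cvgB; [exact: cvg_id|exact: cvg_cst].
have c2 : {for t, continuous (fun t => 2^-1 - (cos (t - x / 2) - cos (x / 2)) / 4)}.
  apply: cvgB; first exact: cvg_cst.
  by apply: cvgM; last exact: cvg_cst; apply: cvgB => //; exact: cvg_cst.
apply: (@continuous_comp _ _ _ (fun t => 1 - (2^-1 - (cos (t - x / 2) - cos (x / 2)) / 4) ^+ n) (fun y : R => y ^+ (2 ^ n))).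
  apply: cvgB; first exact: cvg_cst.
  by apply: (@continuous_comp _ _ _ (fun t => 2^-1 - (cos (t - x / 2) - cos (x / 2)) / 4) (fun y : R => y ^+ n)) => //; exact: exprn_continuous.
exact: exprn_continuous.
Qed.

Lemma kuhn_complex n (y : R) :
  (kuhn n y)%:C%C = (1 - y%:C%C ^+ n) ^+ (2 ^ n) :> C.
Proof.
rewrite /kuhn -(rmorphXn (real_complex R)) -(rmorph1 (real_complex R)).
by rewrite -(rmorphB (real_complex R)) -(rmorphXn (real_complex R)).
Qed.

Definition arcs_zero (v : R -> R) :=
  forall n x, \int[mu]_(t in angles) (kuhn n (arc x t) * v t) = 0.

(** Dominated convergence with bound |v|, as [kuhn] stays in [0, 1] on the values of [arc]. *)
Lemma arcs_integral (v : R -> R) x : mu.-integrable angles (EFin \o v) ->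
  arcs_zero v -> 0 < x < 2 * pi ->
  \int[mu]_(t in angles) (v \_ `]-oo, x]) t = 0.
Proof.
move=> iv Hv x02.
have /measurable_int/measurable_EFinP mv := iv.
have ma := @measurable_angles R.
have mxi : measurable (`]-oo, x] : set R) by exact: measurable_itv.
have ik n : mu.-integrable angles (EFin \o (fun t => kuhn n (arc x t) * v t)).
  apply: (@integrable_le _ _ (fun t => `|v t|)).
  - by apply: measurable_funM => //; exact: measurable_kuhn_arc.
  - move=> t; have /andP[k0 k1] := kuhn_01 n (arc_01 x t).
    by rewrite normrM ger0_norm // -[leRHS]mul1r ler_wpM2r.
  - exact: (integrable_norm iv).
have /andP[x0 x2] := x02.
(* At 0, x and 2 pi the value of [arc] is 1/2, where [kuhn] tends to neither 0 nor 1. *)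
have ae3 : {ae mu, forall t, angles t -> [/\ 0 < t < 2 * pi & t != x]}.
  have := ae_and (ae_neq x) (ae_and (ae_neq 0) (ae_neq (2 * pi))).
  apply: ae_imp => t [tx [t0 t2]].
  rewrite /angles /= in_itv /= => /andP[h1 h2]; split => //.
  by rewrite !lt_neqAle h1 h2 t2 eq_sym t0.
have [] := @dominated_convergence _ _ _ mu angles ma
  (fun n t => (kuhn n (arc x t) * v t)%:E) (fun t => ((v \_ `]-oo, x]) t)%:E)
  (fun t => `|(v t)%:E|%E).
- by move=> n; have /measurable_int := ik n.
- apply/measurable_EFinP/(measurable_restrict _ mxi ma).
  by apply: measurable_funS mv => // t [].
- apply: (ae_imp _ ae3) => t + At.
  move=> /(_ At) [t02 tx]; have Hc := kuhn_arc x02 t02 tx.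
  apply: cvg_EFin; first exact: nearW.
  rewrite patchE mem_setE in_itv /= le_eqVlt (negbTE tx) /=.
  rewrite (_ : (if _ then _ else _) = (if t < x then 1 else 0) * v t); last first.
    by case: ifP => _; rewrite ?mul1r ?mul0r.
  by apply: cvgM => //; exact: cvg_cst.
- exact: integrable_abse.
- apply: aeW => t n _; have /andP[k0 k1] := kuhn_01 n (arc_01 x t).
  by rewrite /= lee_fin normrM ger0_norm // -[leRHS]mul1r ler_wpM2r.
move=> _ _; set s := (X in X @ _ --> _) => Hs.
have E : s = fun=> 0%E.
  apply/funext => n; rewrite /s -[RHS]/(0%:E) -(Hv n x) /Rintegral fineK //.
  exact: integrable_fin_num (ik n).
rewrite /Rintegral; move: Hs; rewrite E => /cvg_lim <- //.
by rewrite lim_cst.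
Qed.

(** Extended by zero outside [angles], v has a primitive from -oo that vanishes on (0, 2 pi). Almost
    everywhere the derivative of this primitive is v, so v is zero there. *)
Lemma arcs_zero_ae (v : R -> R) : mu.-integrable angles (EFin \o v) ->
  arcs_zero v -> {ae mu, forall t, angles t -> v t = 0}.
Proof.
move=> iv Hv; have ma := @measurable_angles R.
pose U := v \_ angles.
have iU : mu.-integrable setT (EFin \o U).
  by move: (iv); rewrite integrable_mkcond // restrict_EFin.
have iUy y : mu.-integrable `]-oo, y] (EFin \o U).
  exact: integrableS iU.
have lU := open_integrable_locally openT iU.
have H := FTC1Ny iUy lU.
have F0 x : 0 < x < 2 * pi -> \int[mu]_(t in `]-oo, x]) U t = 0.
  move=> x02; rewrite -[RHS](arcs_integral iv Hv x02).
  by rewrite /U -Rintegral_mkcondl -Rintegral_mkcondr.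
have := ae_and H (ae_and (ae_neq 0) (ae_neq (2 * pi))).
apply: ae_imp => t [[_ Ht] [t0 t2]].
move=> At; have : 0 < t < 2 * pi.
  move: (At); rewrite /angles /= in_itv /= => /andP[h1 h2].
  by rewrite !lt_neqAle h1 h2 t2 eq_sym t0.
move=> t02; have -> : v t = U t by rewrite /U patchE mem_set.
rewrite -Ht derive1E.
rewrite (@near_eq_derive _ _ _ _ (cst 0)) ?derive_cst //.
have := @near_in_itvoo _ 0 (2 * pi) t; rewrite in_itv /= => /(_ t02).
by apply: filterS => y; rewrite in_itv /= => /F0 ->.
Qed.

(** On the circle z^p conj z^q collapses to a power of z or of conj z, so f annihilates all
    trigonometric polynomials. Those built from [kuhn] are real-valued, and the real and imaginary
    parts of f separate. *)
Lemma fourier_unique f : itg f ->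
  (forall m, intT (fun z => f z * z ^+ m) = 0) ->
  (forall m, intT (fun z => f z * (z^*) ^+ m) = 0) -> eqT f (fun=> 0).
Proof.
move=> fi H K; have Ha : annihilates f.
  move=> p q; have [pq|qp] := leqP p q.
    rewrite -[RHS](K (q - p)%N); apply: intT_congr => z z1.
    rewrite -[in LHS](subnK pq) exprD; congr (_ * _).
    by rewrite mulrCA -exprMn norm1_mulJ // expr1n mulr1.
  rewrite -[RHS](H (p - q)%N); apply: intT_congr => z z1.
  rewrite -[in LHS](subnK (ltnW qp)) exprD; congr (_ * _).
  by rewrite -mulrA -exprMn norm1_mulJ // expr1n mulr1.
have [ir ii] := fi.
have Hz n x : Complex (\int[mu]_(t in angles) (kuhn n (arc x t) * complex.Re (f (cis t))))
    (\int[mu]_(t in angles) (kuhn n (arc x t) * complex.Im (f (cis t)))) = 0.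
  have := annihilates_kuhn (2^-1 + cos (x / 2) / 4)%:C%C
    (Complex (- cos (x / 2) / 8) (sin (x / 2) / 8)) n fi Ha.
  have E t : (1 - trig1 (2^-1 + cos (x / 2) / 4)%:C%C
    (Complex (- cos (x / 2) / 8) (sin (x / 2) / 8)) (cis t) ^+ n) ^+ (2 ^ n)
    = (kuhn n (arc x t))%:C%C.
    by rewrite trig1_arc kuhn_complex.
  have pi0 : (2 * pi)^-1 != 0 :> R by rewrite invr_eq0 gt_eqF ?pi2_gt0.
  rewrite /intT.
  under eq_Rintegral => t _ do rewrite E cReM /= mul0r subr0.
  under [in X in Complex _ X]eq_Rintegral => t _ do rewrite E cImM /= mul0r addr0.
  by case=> /eqP + /eqP; rewrite !mulf_eq0 (negbTE pi0) /= => /eqP -> /eqP ->.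
have /(arcs_zero_ae ir) hr : arcs_zero (fun t => complex.Re (f (cis t))).
  by move=> n x; have [] := Hz n x.
have /(arcs_zero_ae ii) hi : arcs_zero (fun t => complex.Im (f (cis t))).
  by move=> n x; have [] := Hz n x.
have := ae_and hr hi; rewrite /eqT /aeT.
apply: ae_imp => t [h1 h2] At.
by apply: complex_ext; [rewrite h1|rewrite h2].
Qed.

(** After subtraction of the mean all Fourier coefficients vanish: those of negative index because f
    is in H2, those of positive index because conj f is. *)
Lemma H2_conj_cst f : H2 f -> H2 (fun z => (f z)^*) -> exists c : C, eqT f (fun=> c).
Proof.
move=> /H2P[lf Hf] /H2P[_ HJ]; exists (intT f).
have lc := L2_cst (intT f); have lX m := L2_bdd (bddTX R m).
have lJX m : L2 (fun z : C => (z^*) ^+ m) := L2_bdd (bddT_conjX m).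
have : eqT (fun z => f z - intT f) (fun=> 0).
  have i0 : intT (fun z => f z - intT f) = 0.
    by rewrite intTB ?intT_cst ?subrr //; exact: itg_L2.
  apply: fourier_unique; first by apply: itg_L2; exact: L2B.
    case=> [|m]; first by under eq_fun do rewrite expr0 mulr1.
    under eq_fun do rewrite mulrBl.
    rewrite intTB ?Hf ?intTZ ?intT_expr ?mulr0 ?subr0 //; first exact: itg_L2.
      exact: itgM.
    exact: itgM.
  case=> [|m]; first by under eq_fun do rewrite expr0 mulr1.
  under eq_fun do rewrite mulrBl.
  rewrite intTB ?intTZ; [|exact: itg_L2|exact: itgM|exact: itgM].
  have -> : intT (fun z => f z * (z^*) ^+ m.+1) = 0.
    rewrite -[RHS]conjC0 -(HJ m) -intTJ; last by apply: itgM => //; exact: L2J.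
    by apply: intT_congr => z _; rewrite rmorphM /= conjCK rmorphXn.
  have -> : intT (fun z : C => (z^*) ^+ m.+1) = 0; last by rewrite mulr0 subr0.
  rewrite -[RHS]conjC0 -(intT_expr R m) -intTJ; last exact: itg_L2.
  by apply: intT_congr => z _; rewrite rmorphXn.
by apply: aeTW => z _ /eqP; rewrite subr_eq0 => /eqP.
Qed.

End FourierUniqueness.

(** * Projections, Toeplitz operators and their adjoints *)

Section Operators.
Variable R : realType.
Local Notation C := R[i].
Local Notation intT := (@intT R).
Local Notation H2 := (@H2 R).
Local Notation L2 := (@L2 R).
Local Notation proj := (@Defs.proj R _ _).

Lemma aeT_forall (I : finType) (P : I -> C -> Prop) :
  (forall i, aeT (P i)) -> aeT (fun z => forall i, P i z).
Proof.
move=> H.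
have : aeT (fun z => forall i, i \in enum I -> P i z).
  elim: (enum I) => [|i s IH]; first by apply: aeT_circle.
  apply: (aeTW _ (aeT_and (H i) IH)) => z _ [Pi Ps] j.
  by rewrite inE => /predU1P[->//|]; exact: Ps.
by apply: aeTW => z _ K i; apply: K; rewrite mem_enum.
Qed.

Lemma eqT_mx n m (F G : C -> 'M[C]_(n, m)) :
  (forall i j, eqT (fun z => F z i j) (fun z => G z i j)) -> eqT F G.
Proof.
move=> H; have : aeT (fun z => forall i j, F z i j = G z i j).
  by apply: aeT_forall => i; apply: aeT_forall => j; exact: H.
by apply: aeTW => z _ E; apply/matrixP.
Qed.

Lemma eqT_entry n m (F G : C -> 'M[C]_(n, m)) i j :
  eqT F G -> eqT (fun z => F z i j) (fun z => G z i j).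
Proof. by apply: aeTW => z _ ->. Qed.

Lemma H2_ae (f g : C -> C) : L2 f -> eqT f g -> H2 g -> H2 f.
Proof.
move=> lf E Hg; have /H2P[lg Hm] := Hg; apply/H2P; split => // m.
rewrite -[RHS](Hm m); apply: intT_ae.
- by apply: measTM; [exact: L2_measurable|case: (bddTX R m.+1)].
- by apply: measTM; [exact: L2_measurable|case: (bddTX R m.+1)].
- by apply: (aeTW _ E) => z _ /= ->.
Qed.

(** Test functions supported in one entry; pairing with them turns orthogonality of matrix functions
    into orthogonality of each entry. *)
Definition single n m (i : 'I_n) (j : 'I_m) (k : C -> C) : C -> 'M[C]_(n, m) :=
  fun z => k z *: delta_mx i j.

Lemma entries_single n m (i : 'I_n) (j : 'I_m) k : H2 k -> entries H2 (single i j k).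
Proof.
move=> Hk i' j'; rewrite /single.
under eq_fun do rewrite !mxE mulrC.
exact: H2Z.
Qed.

Lemma inner_prod_single n m (F : C -> 'M[C]_(n, m)) i j k :
  inner_prod F (single i j k) = intT (fun z => F z i j * (k z)^*).
Proof.
rewrite /inner_prod (bigD1 i) //= (bigD1 j) //= !big1 ?addr0.
- by apply: intT_congr => z _; rewrite !mxE !eqxx mulr1.
- move=> i' ni; rewrite big1 // => j' _.
  rewrite -[RHS](intT_cst (0 : C)); apply: intT_congr => z _.
  by rewrite !mxE (negbTE ni) mulr0 conjC0 mulr0.
- move=> j' nj; rewrite -[RHS](intT_cst (0 : C)); apply: intT_congr => z _.
  by rewrite !mxE eqxx (negbTE nj) mulr0 conjC0 mulr0.
Qed.

Lemma inner_prodC n m (F G : C -> 'M[C]_(n, m)) :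
  entries L2 F -> entries L2 G -> inner_prod F G = (inner_prod G F)^*.
Proof.
move=> lF lG; rewrite /inner_prod rmorph_sum /=; apply: eq_bigr => i _.
rewrite rmorph_sum /=; apply: eq_bigr => j _.
rewrite -intTJ; last by apply: itgM; [exact: lG|exact: L2J (lF i j)].
by apply: intT_congr => z _; rewrite rmorphM /= conjCK mulrC.
Qed.

Lemma inner_prodE n m (F G : C -> 'M[C]_(n, m)) :
  entries L2 F -> entries L2 G ->
  inner_prod F G = intT (fun z => \sum_i \sum_j F z i j * (G z i j)^*).
Proof.
move=> lF lG.
have i1 i j : itg (fun z => F z i j * (G z i j)^*).
  by apply: itgM; [exact: lF|exact: L2J (lG i j)].
rewrite intT_sum => [|i _]; last by apply: itg_sum.
by apply: eq_bigr => i _; rewrite intT_sum.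
Qed.

Lemma entries_H2_L2 n m (F : C -> 'M[C]_(n, m)) : entries H2 F -> entries L2 F.
Proof. by move=> HF i j; exact: H2_L2. Qed.

Lemma inner_prod_hproj n m (F F' G : C -> 'M[C]_(n, m)) :
  (forall i j, hproj (fun z => F z i j) (fun z => F' z i j)) -> entries H2 G ->
  inner_prod F G = inner_prod F' G.
Proof.
move=> HF HG; apply: eq_bigr => i _; apply: eq_bigr => j _.
have [lF HF' /(_ _ (HG i j)) H] := HF i j.
have lG := H2_L2 (HG i j); have lF' := H2_L2 HF'.
apply/eqP; rewrite -subr_eq0 -intTB; first last.
- by apply: itgM => //; exact: L2J.
- by apply: itgM => //; exact: L2J.
by apply/eqP; rewrite -[RHS]H; apply: intT_congr => z _; rewrite mulrBl.
Qed.

(** Entrywise projections, assembled into [F0], show that the set in the definition of [proj] is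
    inhabited; [xget] then satisfies its defining property, which is read entry by entry through
    [single]. *)
Lemma proj_hproj n m (F : C -> 'M[C]_(n, m)) :
  (forall i j, has_hproj (fun z => F z i j)) ->
  forall i j, hproj (fun z => F z i j) (fun z => proj F z i j).
Proof.
move=> hF.
pose g i j := xget (fun=> 0) (hproj (fun z => F z i j)).
have Hg i j : hproj (fun z => F z i j) (g i j).
  apply: (@xgetPex _ (fun=> 0) (hproj (fun z => F z i j))); exact: hF.
pose F0 z := \matrix_(i, j) g i j z.
have [HP orth] : [set F' | entries H2 F' /\ forall G, entries H2 G ->
    inner_prod (fun z => F z - F' z) G = 0] (proj F).
  apply: xgetPex; exists F0; split.
    by move=> i j; rewrite /F0; under eq_fun do rewrite mxE; have [] := Hg i j.
  move=> G HG; rewrite /inner_prod big1 // => i _; rewrite big1 // => j _.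
  have [_ _ /(_ _ (HG i j)) H] := Hg i j; rewrite -[RHS]H.
  by apply: intT_congr => z _; rewrite !mxE.
move=> i j; split; [by have [] := Hg i j|exact: HP|] => k Hk.
rewrite -[RHS](orth _ (entries_single i j Hk)) inner_prod_single.
by apply: intT_congr => z _; rewrite !mxE.
Qed.

Lemma toeplitz_hproj n (Phi : C -> 'M[C]_n) (F : C -> 'cV[C]_n) :
  (forall i j, has_hproj (fun z => (Phi z *m F z) i j)) ->
  forall i j, hproj (fun z => (Phi z *m F z) i j) (fun z => toeplitz Phi F z i j).
Proof. by move=> H; exact: (@proj_hproj _ _ (fun z => Phi z *m F z)). Qed.

Lemma adjoint_mulmx n (A : 'M[C]_n) (u v : 'cV[C]_n) :
  \sum_i \sum_j (A *m u) i j * (v i j)^* =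
  \sum_i \sum_j u i j * ((A^t* *m v) i j)^*.
Proof.
have E (x y : 'cV[C]_n) : \sum_i \sum_j x i j * (y i j)^* = (y^t* *m x) 0 0.
  rewrite mxE; apply: eq_bigr => i _; rewrite big_ord1 !mxE mulrC //.
have Ev : (A^t* *m v)^t* = v^t* *m A.
  rewrite trmx_mul map_mxM; congr (_ *m _).
  by apply/matrixP => i j; rewrite !mxE /= conjCK.
by rewrite E [RHS]E Ev mulmxA.
Qed.

(** The adjoint of the Toeplitz operator is F |-> P(Phi^* F). This map proves that some adjoint
    exists; the one chosen by [xget] is then compared with Phi^* F by pairing with [single]
    functions. *)
Lemma adjoint_hproj n (Phi : C -> 'M[C]_n) :
  (forall i j, bddT (fun z => Phi z i j)) ->
  (forall F : C -> 'cV[C]_n, entries H2 F ->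
     forall i j, has_hproj (fun z => (Phi z *m F z) i j)) ->
  (forall F : C -> 'cV[C]_n, entries H2 F ->
     forall i j, has_hproj (fun z => ((Phi z)^t* *m F z) i j)) ->
  forall F : C -> 'cV[C]_n, entries H2 F -> forall i j,
  hproj (fun z => ((Phi z)^t* *m F z) i j)
        (fun z => adjoint (toeplitz Phi) F z i j).
Proof.
move=> bPhi hP hPa F HF i j.
have lmul (Psi : C -> 'M[C]_n) (G : C -> 'cV[C]_n) :
    (forall i j, bddT (fun z => Psi z i j)) ->
    entries H2 G -> entries L2 (fun z => Psi z *m G z).
  move=> bPsi HG i' j'; under eq_fun do rewrite mxE.
  by apply: L2_sum => k _; apply: L2_bddM => //; exact: H2_L2.
have bPhia i' j' : bddT (fun z => (Phi z)^t* i' j').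
  by under eq_fun do rewrite !mxE; exact: bddTJ.
have key G K : entries H2 G -> entries H2 K ->
    inner_prod (toeplitz Phi G) K = inner_prod G (fun z => (Phi z)^t* *m K z).
  move=> HG HK; rewrite -(inner_prod_hproj (toeplitz_hproj (hP G HG)) HK).
  rewrite !inner_prodE; try exact: entries_H2_L2; try exact: lmul.
  by apply: intT_congr => z _; exact: adjoint_mulmx.
have adjP : [set S | forall F, entries H2 F -> entries H2 (S F) /\
    forall G, entries H2 G ->
    inner_prod (toeplitz Phi G) F = inner_prod G (S F)] (adjoint (toeplitz Phi)).
  apply: xgetPex; exists (fun K => proj (fun z => (Phi z)^t* *m K z)) => K HK.
  have Hp := proj_hproj (hPa K HK).
  have Hp2 : entries H2 (proj (fun z => (Phi z)^t* *m K z)).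
    by move=> i' j'; have [] := Hp i' j'.
  split => // G HG; rewrite key // inner_prodC; [|exact: entries_H2_L2|exact: lmul].
  rewrite [RHS]inner_prodC; [|exact: entries_H2_L2|exact: entries_H2_L2].
  by rewrite (inner_prod_hproj Hp HG).
have [HS HSG] := adjP F HF.
split; [exact: lmul|exact: HS|] => k Hk.
have lk := H2_L2 Hk; have lS := H2_L2 (HS i j); have lU := lmul _ _ bPhia HF i j.
have Hs := entries_single i j Hk.
have E := HSG _ Hs; rewrite key // in E.
move/(congr1 Num.conj): E; rewrite -!inner_prodC; try exact: entries_H2_L2; try exact: lmul.
rewrite !inner_prod_single => E.
under eq_fun do rewrite mulrBl.
by rewrite intTB ?E ?subrr //; apply: itgM => //; exact: L2J.
Qed.

Lemma selfcommE n (T : oper R n) F z i j :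
  selfcomm T F z i j = adjoint T (T F) z i j - T (adjoint T F) z i j.
Proof. by rewrite /selfcomm mxE [X in _ + X]mxE. Qed.

End Operators.

(** * The self-commutator *)

Section Example.
Variable R : realType.
Local Notation C := R[i].
Local Notation intT := (@intT R).
Local Notation H2 := (@H2 R).
Local Notation L2 := (@L2 R).

Lemma ord2P (i : 'I_2) : i = 0 \/ i = 1.
Proof. by case: i => [[|[|//]] H]; [left|right]; exact: val_inj. Qed.

Lemma eqT_D (f g h k : C -> C) : eqT f g -> eqT h k ->
  eqT (fun z => f z + h z) (fun z => g z + k z).
Proof. by move=> H1 H2; apply: (aeTW _ (aeT_and H1 H2)) => z _ [-> ->]. Qed.

Variable th : C -> C.
Hypothesis tth : tractable th.

Lemma bdd_th : bddT th.
Proof. exact: tractable_bdd. Qed.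

Lemma th_unimodular z : `|z| = 1 -> th z * (th z)^* = 1.
Proof. by case: tth => _ n _ _ _ /n; exact: norm1_mulJ. Qed.

Lemma H2_thM f : H2 f -> H2 (fun z => th z * f z).
Proof. by case: tth => _ _ + _ _; apply. Qed.

Lemma H2_th : H2 th.
Proof. by apply: H2_congr (H2_thM (H2_cst 1)) => z _; rewrite mulr1. Qed.

Lemma has_hproj_thJ f : H2 f -> has_hproj (fun z => (th z)^* * f z).
Proof. by case: tth => _ _ _ + _; apply. Qed.

Lemma intT_thM f : H2 f -> intT (fun z => th z * f z) = th 0 * intT f.
Proof. by case: tth => _ _ _ _; apply. Qed.

Lemma thJ_th (z w : C) : `|z| = 1 -> (th z)^* * (th z * w) = w.
Proof. by move=> z1; rewrite mulrCA mulrA th_unimodular // mul1r. Qed.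

Lemma th_thJ (z w : C) : `|z| = 1 -> th z * ((th z)^* * w) = w.
Proof. by move=> z1; rewrite mulrA th_unimodular // mul1r. Qed.

Lemma L2_thJ f : L2 f -> L2 (fun z => (th z)^* * f z).
Proof. by apply: L2_bddM; apply: bddTJ; exact: bdd_th. Qed.

Lemma L2_thM f : L2 f -> L2 (fun z => th z * f z).
Proof. by apply: L2_bddM; exact: bdd_th. Qed.

(** As |th| = 1, pairing f - th l with th g is pairing conj th f - l with g. *)
Lemma hproj_Hmodel f l : H2 f -> hproj (fun z => (th z)^* * f z) l ->
  Hmodel th (fun z => f z - th z * l z).
Proof.
move=> Hf [lf Hl H]; split; first by apply: H2B => //; exact: H2_thM.
move=> g Hg; rewrite -[RHS](H g Hg); apply: intT_congr => z z1.
by rewrite rmorphM /= mulrA [_ * (th z)^*]mulrC mulrBr thJ_th.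
Qed.

(** Converse of [hproj_Hmodel]: any decomposition of f along th H2 and H_theta has the projection of
    conj th f as its quotient. *)
Lemma Hmodel_hproj f g h : H2 g -> Hmodel th h -> L2 f -> eqT f (fun z => th z * g z + h z) ->
  hproj (fun z => (th z)^* * f z) g.
Proof.
move=> Hg [Hh Ho] lf E.
have lh := H2_L2 Hh; have lg := H2_L2 Hg.
have lu : L2 (fun z => (th z)^* * (th z * g z + h z)).
  by apply: L2_thJ; apply: L2D => //; exact: L2_thM.
apply: (@hproj_ae _ (fun z => (th z)^* * (th z * g z + h z))).
- by apply: (aeTW _ (eqT_sym E)) => z _ /= ->.
- exact: L2_thJ.
split => // k Hk; rewrite -[RHS](Ho k Hk); apply: intT_congr => z z1.
by rewrite mulrDr thJ_th // rmorphM /=; ring.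
Qed.

Lemma ex_Phi_mulmx z (v : 'cV[C]_2) i :
  (ex_Phi th z *m v) i 0 = 2 * th z * v i 0 + (th z)^* * (v 0 0 + v 1 0).
Proof.
rewrite mxE !big_ord_recl big_ord0 !mxE /=.
have -> : lift ord0 ord0 = 1 :> 'I_2 by exact: val_inj.
by case: (ord2P i) => -> /=; ring.
Qed.

Lemma ex_Phi_adj z : (ex_Phi th z)^t* =
  mx2 (2 * (th z)^* + th z) (th z) (th z) (2 * (th z)^* + th z).
Proof.
apply/matrixP => i j.
by case: (ord2P i) => ->; case: (ord2P j) => ->; rewrite !mxE /= ?rmorphD ?rmorphM ?rmorph_nat /= ?conjCK.
Qed.

Lemma ex_Phi_adj_mulmx z (v : 'cV[C]_2) i :
  ((ex_Phi th z)^t* *m v) i 0 = 2 * (th z)^* * v i 0 + th z * (v 0 0 + v 1 0).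
Proof.
rewrite ex_Phi_adj mxE !big_ord_recl big_ord0 !mxE /=.
have -> : lift ord0 ord0 = 1 :> 'I_2 by exact: val_inj.
by case: (ord2P i) => -> /=; ring.
Qed.

(** The entries of Phi F have this shape with (c, d) = (2, 1), and those of Phi^* F with (c, d) =
    (1, 2). *)
Lemma hproj_comb (c d : C) f g l : H2 f -> hproj (fun z => (th z)^* * g z) l ->
  hproj (fun z => c * th z * f z + d * ((th z)^* * g z)) (fun z => c * th z * f z + d * l z).
Proof.
move=> Hf Hl; apply: hprojD; last exact: hprojZ.
have E : (fun z => c * th z * f z) = (fun z => c * (th z * f z)).
  by apply/funext => z; rewrite mulrA.
by rewrite E; apply: hprojZ; apply: hproj_H2; exact: H2_thM.
Qed.

Lemma toeplitz_ex_hproj (F : C -> 'cV[C]_2) l : entries H2 F ->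
  hproj (fun z => (th z)^* * (F z 0 0 + F z 1 0)) l ->
  forall i, hproj (fun z => (ex_Phi th z *m F z) i 0) (fun z => 2 * th z * F z i 0 + l z).
Proof.
move=> HF Hl i.
apply: (@hproj_congr _ (fun z => 2 * th z * F z i 0 + 1 * ((th z)^* * (F z 0 0 + F z 1 0)))).
  by move=> z _; rewrite ex_Phi_mulmx mul1r.
have := @hproj_comb 2 1 _ _ l (HF i 0) Hl.
by under [X in hproj _ X]eq_fun do rewrite mul1r.
Qed.

Lemma adjoint_ex_hproj (F : C -> 'cV[C]_2) l i : entries H2 F ->
  hproj (fun z => (th z)^* * F z i 0) l ->
  hproj (fun z => ((ex_Phi th z)^t* *m F z) i 0)
        (fun z => 2 * l z + th z * (F z 0 0 + F z 1 0)).
Proof.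
move=> HF Hl.
have Hs : H2 (fun z => F z 0 0 + F z 1 0) by apply: H2D; exact: HF.
apply: (@hproj_congr _ (fun z => 1 * th z * (F z 0 0 + F z 1 0) + 2 * ((th z)^* * F z i 0))).
  by move=> z _; rewrite ex_Phi_adj_mulmx; ring.
have := @hproj_comb 1 2 _ _ l Hs Hl.
by under [X in hproj _ X]eq_fun do rewrite mul1r addrC.
Qed.

Local Notation TPhi := (toeplitz (ex_Phi th)).

Lemma has_hproj_ex (F : C -> 'cV[C]_2) : entries H2 F ->
  forall i j, has_hproj (fun z => (ex_Phi th z *m F z) i j).
Proof.
move=> HF i j; rewrite ord1.
have [l Hl] : has_hproj (fun z => (th z)^* * (F z 0 0 + F z 1 0)).
  by apply: has_hproj_thJ; apply: H2D; exact: HF.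
by eexists; exact: toeplitz_ex_hproj Hl i.
Qed.

Lemma has_hproj_ex_adj (F : C -> 'cV[C]_2) : entries H2 F ->
  forall i j, has_hproj (fun z => ((ex_Phi th z)^t* *m F z) i j).
Proof.
move=> HF i j; rewrite ord1.
have [l Hl] := has_hproj_thJ (HF i 0).
by eexists; exact: adjoint_ex_hproj HF Hl.
Qed.

Lemma bdd_ex i j : bddT (fun z => ex_Phi th z i j).
Proof.
have b1 : bddT (fun z => (th z)^*) by apply: bddTJ; exact: bdd_th.
have b2 : bddT (fun z => 2 * th z + (th z)^*).
  by apply: bddTD => //; apply: bddTM; [exact: bddT_cst|exact: bdd_th].
by case: (ord2P i) => ->; case: (ord2P j) => ->; rewrite /ex_Phi;
  under eq_fun do rewrite mxE /=.
Qed.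

Lemma toeplitz_exE (F : C -> 'cV[C]_2) l : entries H2 F ->
  hproj (fun z => (th z)^* * (F z 0 0 + F z 1 0)) l ->
  forall i, eqT (fun z => TPhi F z i 0) (fun z => 2 * th z * F z i 0 + l z).
Proof.
move=> HF Hl i; apply: hproj_inj (toeplitz_ex_hproj HF Hl i).
exact: (toeplitz_hproj (has_hproj_ex HF)).
Qed.

Lemma entries_toeplitz_ex (F : C -> 'cV[C]_2) : entries H2 F -> entries H2 (TPhi F).
Proof. by move=> HF i j; have [] := toeplitz_hproj (has_hproj_ex HF) i j. Qed.

Lemma adjoint_exE (F : C -> 'cV[C]_2) l i : entries H2 F ->
  hproj (fun z => (th z)^* * F z i 0) l ->
  eqT (fun z => adjoint TPhi F z i 0) (fun z => 2 * l z + th z * (F z 0 0 + F z 1 0)).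
Proof.
move=> HF Hl; apply: hproj_inj (adjoint_ex_hproj HF Hl).
exact: (adjoint_hproj bdd_ex has_hproj_ex has_hproj_ex_adj HF).
Qed.

Lemma entries_adjoint_ex (F : C -> 'cV[C]_2) : entries H2 F -> entries H2 (adjoint TPhi F).
Proof.
by move=> HF i j; have [] := adjoint_hproj bdd_ex has_hproj_ex has_hproj_ex_adj HF i j.
Qed.

Lemma hproj_thJ_th f : H2 f -> hproj (fun z => (th z)^* * (th z * f z)) f.
Proof. by move=> Hf; apply: hproj_congr (hproj_H2 Hf) => z z1; rewrite thJ_th. Qed.

Lemma hproj_thJD f g l m : hproj (fun z => (th z)^* * f z) l ->
  hproj (fun z => (th z)^* * g z) m ->
  hproj (fun z => (th z)^* * (f z + g z)) (fun z => l z + m z).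
Proof. by move=> Hl Hm; apply: hproj_congr (hprojD Hl Hm) => z _; rewrite mulrDr. Qed.

Lemma hproj_thJZ (c : C) f l : hproj (fun z => (th z)^* * f z) l ->
  hproj (fun z => (th z)^* * (c * f z)) (fun z => c * l z).
Proof. by move=> Hl; apply: hproj_congr (hprojZ c Hl) => z _; rewrite mulrCA. Qed.

Lemma hproj_thJ_ae f g l : L2 g -> eqT f g -> hproj (fun z => (th z)^* * f z) l ->
  hproj (fun z => (th z)^* * g z) l.
Proof.
move=> lg E; apply: hproj_ae; last exact: L2_thJ.
by apply: (aeTW _ E) => z _ /= ->.
Qed.

(* [T^*, T] = (4 - J^2)(I - th L) with L the projected division by th and J = ones2, J^2 = 2 J. *)
Lemma selfcomm_exE (F : C -> 'cV[C]_2) l0 l1 : entries H2 F ->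
  hproj (fun z => (th z)^* * F z 0 0) l0 -> hproj (fun z => (th z)^* * F z 1 0) l1 ->
  forall i, eqT (fun z => selfcomm TPhi F z i 0)
    (fun z => 4 * (F z i 0 - th z * (if i == 0 then l0 else l1) z)
      - 2 * (F z 0 0 - th z * l0 z + (F z 1 0 - th z * l1 z))).
Proof.
move=> HF H0 H1 i.
pose ls z := l0 z + l1 z; pose s z := F z 0 0 + F z 1 0.
pose l (i : 'I_2) := if i == 0 then l0 else l1.
have Hl j : hproj (fun z => (th z)^* * F z j 0) (l j).
  by case: (ord2P j) => ->.
have Hls : hproj (fun z => (th z)^* * s z) ls by exact: hproj_thJD.
have Hs : H2 s by apply: H2D; exact: HF.
have [_ Hls2 _] := Hls.
have [m Hm] := has_hproj_thJ Hls2.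
have HTF := entries_toeplitz_ex HF; have HAF := entries_adjoint_ex HF.
have ET j := toeplitz_exE HF Hls j.
have EA j := adjoint_exE HF (Hl j).
(* T F has entries th (2 F_i) + ls; division by th leaves 2 F_i and the quotient [m] of [ls]. *)
have P1 : hproj (fun z => (th z)^* * TPhi F z i 0) (fun z => 2 * F z i 0 + m z).
  apply: (@hproj_thJ_ae (fun z => th z * (2 * F z i 0) + ls z)).
  - exact: H2_L2.
  - by apply: (aeTW _ (eqT_sym (ET i))) => z _ <-; ring.
  - by apply: hproj_thJD => //; apply: hproj_thJ_th; exact: H2Z.
have P2 : hproj (fun z => (th z)^* * (adjoint TPhi F z 0 0 + adjoint TPhi F z 1 0))
    (fun z => 2 * m z + 2 * s z).
  apply: (@hproj_thJ_ae (fun z => 2 * ls z + th z * (2 * s z))).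
  - by apply: L2D; exact: H2_L2.
  - have /eqT_sym E := eqT_D (EA 0) (EA 1).
    by apply: (aeTW _ E) => z _ <-; rewrite /l /ls /s /=; ring.
  - by apply: hproj_thJD; [exact: hproj_thJZ|apply: hproj_thJ_th; exact: H2Z].
have E1 := adjoint_exE HTF P1.
have E2 := toeplitz_exE HAF P2 i.
(* Here y stands for [m], the second division by th. It enters T^* T and T T^* with the same factor
   2 and cancels. *)
have alg (x1 x2 x3 x4 x5 t fi f0 f1 li y0 y1 y : C) :
    x1 = 2 * (2 * fi + y) + t * (x4 + x5) -> x2 = 2 * t * x3 + (2 * y + 2 * (f0 + f1)) ->
    x3 = 2 * li + t * (f0 + f1) -> x4 = 2 * t * f0 + (y0 + y1) -> x5 = 2 * t * f1 + (y0 + y1) ->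
    x1 - x2 = 4 * (fi - t * li) - 2 * (f0 - t * y0 + (f1 - t * y1)).
  by move=> -> -> -> -> ->; ring.
apply: (aeTW _ (aeT_and (aeT_and E1 E2) (aeT_and (EA i) (aeT_and (ET 0) (ET 1))))) => z z1.
by rewrite selfcommE => -[[e1 e2] [e3 [e4 e5]]]; exact: alg e1 e2 e3 e4 e5.
Qed.

End Example.

(** * The kernel of the self-commutator and left coprimality *)

Section Kernel.
Variable R : realType.
Local Notation C := R[i].
Local Notation intT := (@intT R).
Local Notation H2 := (@H2 R).
Local Notation L2 := (@L2 R).
Variable th : C -> C.
Hypothesis tth : tractable th.
Local Notation TPhi := (toeplitz (ex_Phi th)).
Local Notation N := (oker (selfcomm TPhi)).

Lemma oker_selfcomm_ex (F : C -> 'cV[C]_2) l0 l1 : entries H2 F ->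
  hproj (fun z => (th z)^* * F z 0 0) l0 -> hproj (fun z => (th z)^* * F z 1 0) l1 ->
  (N F <-> eqT (fun z => F z 0 0 - th z * l0 z) (fun z => F z 1 0 - th z * l1 z)).
Proof.
move=> HF H0 H1; have S := selfcomm_exE tth HF H0 H1; split.
  case=> _ /(@eqT_entry _ _ _ _ _ 0 0) E.
  apply: (aeTW _ (aeT_and E (S 0))) => z _ /= [->]; rewrite mxE.
  set a := F z 0 0 - _; set b := F z 1 0 - _ => Eab.
  have /eqP : 2 * (a - b) = 0 by rewrite [RHS]Eab; ring.
  by rewrite mulf_eq0 pnatr_eq0 /= subr_eq0 => /eqP.
move=> E; split => //; apply: eqT_mx => i j; rewrite ord1.
apply: (aeTW _ (aeT_and E (S i))) => z _ [Eab ->]; rewrite mxE.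
by case: (ord2P i) => -> /=; rewrite Eab; ring.
Qed.

(** With d = q_0 - q_1 the self-commutator sends F to (2 d, -2 d), and pairing with F gives 2 <d,
    F_0 - F_1>. Since F_0 - F_1 = d + th (l0 - l1) and d is orthogonal to th H2, this is 2 <d,
    d>. *)
Lemma hyponormal_ex : hyponormal TPhi.
Proof.
move=> F HF.
have [l0 H0] := has_hproj_thJ tth (HF 0 0); have [l1 H1] := has_hproj_thJ tth (HF 1 0).
have S := selfcomm_exE tth HF H0 H1.
have M0 := hproj_Hmodel tth (HF 0 0) H0; have M1 := hproj_Hmodel tth (HF 1 0) H1.
pose d z := (F z 0 0 - th z * l0 z) - (F z 1 0 - th z * l1 z).
have Hd : H2 d by apply: H2B; [case: M0|case: M1].
have [_ Hl0 _] := H0; have [_ Hl1 _] := H1.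
have Hl : H2 (fun z => l0 z - l1 z) by exact: H2B.
have Hsc : entries L2 (selfcomm TPhi F).
  move=> i j; under eq_fun do rewrite selfcommE.
  apply: L2B; apply: H2_L2.
    by apply: (entries_adjoint_ex tth) => //; exact: entries_toeplitz_ex.
  by apply: (entries_toeplitz_ex tth) => //; exact: entries_adjoint_ex.
have Ei (i : 'I_2) (c : C) : eqT (fun z => selfcomm TPhi F z i 0) (fun z => c * d z) ->
    intT (fun z => selfcomm TPhi F z i 0 * (F z i 0)^*) = c * intT (fun z => d z * (F z i 0)^*).
  move=> E; rewrite -intTZ; last by apply: itgM; [exact: H2_L2|apply: L2J; exact: H2_L2].
  apply: intT_ae.
  - by apply: measTM; [exact: L2_measurable|apply: measTJ; apply: L2_measurable; exact: H2_L2].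
  - apply: measTM; first exact: measT_cst.
    by apply: measTM; [apply: L2_measurable; exact: H2_L2|apply: measTJ; apply: L2_measurable; exact: H2_L2].
  - by apply: (aeTW _ E) => z _ ->; rewrite mulrA.
have E0 : eqT (fun z => selfcomm TPhi F z 0 0) (fun z => 2 * d z).
  by apply: (aeTW _ (S 0)) => z _ -> /=; rewrite /d; ring.
have E1 : eqT (fun z => selfcomm TPhi F z 1 0) (fun z => - 2 * d z).
  by apply: (aeTW _ (S 1)) => z _ -> /=; rewrite /d; ring.
have ld := H2_L2 Hd; have lF i := H2_L2 (HF i 0).
have -> : inner_prod (selfcomm TPhi F) F = 2 * intT (fun z => d z * (d z)^*).
  rewrite /inner_prod !big_ord_recl !big_ord0 !addr0.
  have -> : lift ord0 ord0 = 1 :> 'I_2 by exact: val_inj.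
  rewrite (Ei 0 _ E0) (Ei 1 _ E1) mulNr -mulrBr; congr (_ * _).
  have itgJ2 f : L2 f -> itg (fun z => d z * (f z)^*) by move=> lf; apply: itgM => //; exact: L2J.
  have lthl : L2 (fun z => th z * (l0 z - l1 z)).
    by apply: L2_thM => //; exact: H2_L2.
  have Z : intT (fun z => d z * (th z * (l0 z - l1 z))^*) = 0.
    have [Hq0 K0] := M0; have [Hq1 K1] := M1.
    rewrite -[RHS](subrr 0) -{1}(K0 _ Hl) -(K1 _ Hl) -intTB.
    - by apply: intT_congr => z _; rewrite /d; ring.
    - by apply: itgM; [exact: H2_L2|exact: L2J].
    - by apply: itgM; [exact: H2_L2|exact: L2J].
  rewrite -intTB; try exact: itgJ2.
  rewrite -[RHS]addr0 -[in RHS]Z -intTD; try exact: itgJ2.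
  by apply: intT_congr => z _; rewrite -mulrBr -mulrDr -rmorphB -rmorphD /=; congr (_ * Num.conj _); rewrite /d; ring.
by rewrite mulr_ge0 // intT_norm_ge0.
Qed.

(** The entries of T F are th (2 F_i) + ls with one common [ls], so both have the same remainder ls
    - th m modulo th. *)
Lemma invariant_ex : invariant_under TPhi N.
Proof.
move=> F [HF _]; have HT := entries_toeplitz_ex tth HF.
pose s z := F z 0 0 + F z 1 0.
have [ls Hls] : has_hproj (fun z => (th z)^* * s z).
  by apply: has_hproj_thJ => //; apply: H2D; exact: HF.
have [_ Hls2 _] := Hls; have [m Hm] := has_hproj_thJ tth Hls2.
have ET j := toeplitz_exE tth HF Hls j.
have P1 i : hproj (fun z => (th z)^* * TPhi F z i 0) (fun z => 2 * F z i 0 + m z).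
  apply: (@hproj_thJ_ae _ _ tth (fun z => th z * (2 * F z i 0) + ls z)).
  - exact: H2_L2.
  - by apply: (aeTW _ (eqT_sym (ET i))) => z _ <-; ring.
  - by apply: hproj_thJD => //; apply: hproj_thJ_th => //; exact: H2Z.
apply/(oker_selfcomm_ex HT (P1 0) (P1 1)).
by apply: (aeTW _ (aeT_and (ET 0) (ET 1))) => z _ [-> ->]; ring.
Qed.

Lemma ex_Theta_mulmx z (v : 'cV[C]_2) i : (ex_Theta th z *m v) i 0 = th z * v i 0.
Proof.
rewrite mxE !big_ord_recl big_ord0 !mxE /=.
have -> : lift ord0 ord0 = 1 :> 'I_2 by exact: val_inj.
by case: (ord2P i) => -> /=; ring.
Qed.

Lemma orth_sum_ex : orth_sum N (ThetaH2 th) (diag_model th).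
Proof.
split=> [F1 F2 [G HG ->] [f [Hf Kf] ->]|F].
  rewrite /inner_prod big1 // => i _; rewrite big1 // => j _; rewrite ord1.
  rewrite -[RHS]conjC0 -(Kf _ (HG i 0)) -intTJ.
    by apply: intT_congr => z _; rewrite ex_Theta_mulmx mxE rmorphM /= conjCK; ring.
  by apply: itgM; [exact: H2_L2|apply: L2J; apply: H2_L2; exact: H2_thM].
split=> [NF|[HF [F1 [F2 [[G HG ->] [f Mf ->]] E]]]].
  have [HF _] := NF; split => //.
  have [l0 H0] := has_hproj_thJ tth (HF 0 0); have [l1 H1] := has_hproj_thJ tth (HF 1 0).
  have {NF} E := (oker_selfcomm_ex HF H0 H1).1 NF.
  pose G z : 'cV[C]_2 := \col_i (if i == 0 then l0 z else l1 z).
  exists (fun z => ex_Theta th z *m G z), (fun z => \col_(i < 2) (F z 0 0 - th z * l0 z)).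
  split.
  - exists G => // i j; rewrite /G; under eq_fun do rewrite mxE.
    by case: (ord2P i) => -> /=; [case: H0|case: H1].
  - by exists (fun z => F z 0 0 - th z * l0 z) => //; exact: hproj_Hmodel.
  apply: (aeTW _ E) => z _ Ez; apply/matrixP => i j; rewrite ord1 mxE ex_Theta_mulmx !mxE.
  case: (ord2P i) => -> /=; first by ring.
  by rewrite Ez; ring.
have EF i : eqT (fun z => F z i 0) (fun z => th z * G z i 0 + f z).
  by apply: (aeTW _ E) => z _ ->; rewrite mxE ex_Theta_mulmx mxE.
have P1 i : hproj (fun z => (th z)^* * F z i 0) (fun z => G z i 0).
  by apply: (@Hmodel_hproj _ _ tth _ _ f) => //; exact: H2_L2.
apply/(oker_selfcomm_ex HF (P1 0) (P1 1)).
by apply: (aeTW _ (aeT_and (EF 0) (EF 1))) => z _ [-> ->]; ring.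
Qed.

Variable a : C.
Hypothesis a1 : `|a| < 1.
Hypothesis za : forall f, H2 f -> ev a (fun z => th z * f z) = 0.


Lemma ev_ae (f : C -> C) (c : C) : L2 f -> eqT f (fun=> c) -> ev a f = c.
Proof.
move=> lf E; rewrite -[RHS]mulr1 -(ev_1 a1) -evZ //; last exact: L2_cst.
apply: intT_ae; try exact: itg_measurable (itg_ev a1 _).
  by apply: itg_measurable; apply: itg_ev => //; apply: L2Z; exact: L2_cst.
by apply: (aeTW _ E) => z _ /= ->; rewrite mulr1.
Qed.

(** Evaluation at the zero a forces c = 0, against |th| = 1. *)
Lemma th_nonconstant_ae (c : C) : ~ eqT th (fun=> c).
Proof.
move=> E; have Hth := H2_th tth.
have c0 : c = 0.
  rewrite -(ev_ae (H2_L2 Hth) E) -(za (H2_cst 1)).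
  by apply: ev_congr => z _; rewrite mulr1.
have [z z1 Ez] := aeT_ex E.
have := th_unimodular tth z1; rewrite Ez c0 mul0r => /eqP.
by rewrite eq_sym oner_eq0.
Qed.

(** Otherwise the constant th conj th = 1 would take the value 0 at a. *)
Lemma thJ_not_H2 : ~ H2 (fun z => (th z)^*).
Proof.
move=> /za /eqP; rewrite (@ev_congr _ _ _ (fun=> 1)) ?ev_1 ?oner_eq0 //.
by move=> z z1; rewrite th_unimodular.
Qed.

Lemma not_analytic_ex : ~ analytic_symbol (ex_Phi th).
Proof.
move=> /(_ 0 1) [_]; rewrite /ex_Phi; under eq_fun do rewrite mxE /=.
exact: thJ_not_H2.
Qed.

Lemma not_oker_ex : exists2 F : C -> 'cV[C]_2, entries H2 F & ~ N F.
Proof.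
have bs := szego_bdd a1.
have Hs : H2 (szego a).
  by apply: H2_congr (H2_szego a1 (H2_cst 1)) => z _; rewrite mulr1.
(* k_a is orthogonal to th H2, so conj th k_a projects to 0 and the remainders of the two entries
   are k_a and 0. *)
pose F z : 'cV[C]_2 := \col_i (if i == 0 then szego a z else 0).
have HF : entries H2 F.
  move=> i j; rewrite /F; under eq_fun do rewrite mxE.
  by case: (ord2P i) => -> //=; exact: H2_cst.
exists F => //.
have P0 : hproj (fun z => (th z)^* * F z 0 0) (fun=> 0).
  apply: (@hproj_congr _ (fun z => (th z)^* * szego a z)).
    by move=> z _; rewrite mxE.
  split; [by apply: L2_thJ => //; exact: H2_L2|exact: H2_cst|] => k Hk.
  rewrite -[RHS]conjC0 -[in RHS](za Hk) -intTJ.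
    by apply: intT_congr => z _; rewrite subr0 rmorphM /= conjCK rmorphM; ring.
  by apply: itg_ev => //; apply: L2_thM => //; exact: H2_L2.
have P1 : hproj (fun z => (th z)^* * F z 1 0) (fun=> 0).
  apply: hproj_congr (hproj_H2 (H2_cst (0 : C))) => z _.
  by rewrite mxE /= mulr0.
move/(oker_selfcomm_ex HF P0 P1) => E.
have Es : eqT (szego a) (fun=> 0).
  by apply: (aeTW _ E) => z _; rewrite !mxE /= !mulr0 !subr0.
have := ev_1 a1; rewrite /ev.
have -> : intT (fun z => 1 * (szego a z)^*) = intT (fun=> 0).
  apply: intT_ae.
  - by apply: itg_measurable; apply: itg_ev => //; exact: L2_cst.
  - exact: measT_cst.
  - by apply: (aeTW _ Es) => z _ ->; rewrite conjC0 mulr0.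
by rewrite intT_cst => /eqP; rewrite eq_sym oner_eq0.
Qed.

Lemma not_normal_ex : ~ normal_oper TPhi.
Proof. by have [F HF nF] := not_oker_ex => H; apply: nF; split => //; exact: H. Qed.

Lemma fscalar_ex_Theta : ex_Theta th = fscalar 2 th.
Proof.
apply/funext => z; apply/matrixP => i j.
by case: (ord2P i) => ->; case: (ord2P j) => ->; rewrite !mxE.
Qed.

Lemma H2_mx2 (f g h k : C -> C) : H2 f -> H2 g -> H2 h -> H2 k ->
  entries H2 (fun z => mx2 (f z) (g z) (h z) (k z)).
Proof.
move=> Hf Hg Hh Hk i j; under eq_fun do rewrite mxE.
by case: (ord2P i) => ->; case: (ord2P j) => ->.
Qed.

Definition sqrt_half : C := ((Num.sqrt 2)^-1)%:C%C.

Lemma sqrt_half_sqr : sqrt_half * sqrt_half = 2^-1.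
Proof.
rewrite /sqrt_half -rmorphM -invfM -expr2 sqr_sqrtr // fmorphV.
by rewrite rmorph_nat.
Qed.

Lemma sqrt_halfJ : sqrt_half^* = sqrt_half.
Proof. by apply: complex_ext; rewrite ?cRe_conj ?cIm_conj //= oppr0. Qed.

(* D = U diag(1, th) with U = [[1,1],[1,-1]]/sqrt 2 diagonalizing ones2 = U diag(2,0) U^*. *)
Lemma not_left_coprime_ones2 (b : C -> C) : H2 b ->
  ~ left_coprime (fun z => b z *: @ones2 R) (ex_Theta th).
Proof.
move=> Hb H; have Hth := H2_th tth; set s := sqrt_half.
have ss : s * s = 2^-1 := sqrt_half_sqr; have sJ : s^* = s := sqrt_halfJ.
have h2 : 2^-1 + 2^-1 = 1 :> C by rewrite [RHS](splitr 1) !mul1r.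
pose D z := mx2 s (s * th z) s (- s * th z).
have bD i j : bddT (fun z => D z i j).
  have b1 c : bddT (fun z => c * th z).
    by apply: bddTM; [exact: bddT_cst|exact: bdd_th].
  under eq_fun do rewrite mxE.
  by case: (ord2P i) => ->; case: (ord2P j) => -> //=; exact: bddT_cst.
have HD : entries H2 D by apply: H2_mx2; [exact: H2_cst|exact: H2Z|exact: H2_cst|exact: H2Z].
have iD : mx_inner D.
  split; first by move=> i j; split; [exact: Linf_bdd|exact: HD].
  apply: aeT_circle => z z1; have tt := th_unimodular tth z1.
  apply/matrixP => i j; rewrite mxE !big_ord_recl big_ord0 !mxE /= addr0.
  case: (ord2P i) => ->; case: (ord2P j) => -> /=;
    rewrite ?rmorphM ?rmorphN /= ?sJ ?mulr1n ?mulr0n.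
  - by rewrite ss h2.
  - by ring.
  - by ring.
  - by transitivity ((s * s + s * s) * (th z * (th z)^*)); [ring|rewrite tt ss h2 mulr1].
have dB : left_inner_divisor D (fun z => b z *: @ones2 R).
  (* The quotient is D^* (b J). The second row of U^* J is zero, so conj th does not occur in it. *)
  split => //; exists (fun z => mx2 (2 * s * b z) (2 * s * b z) 0 0); split.
    by apply: H2_mx2; try exact: H2Z; exact: H2_cst.
  apply: aeT_circle => z z1; apply/matrixP => i j.
  rewrite !mxE !big_ord_recl big_ord0 !mxE /=.
  by case: (ord2P i) => ->; case: (ord2P j) => -> /=;
    (transitivity (2 * (s * s) * b z); [rewrite ss mulfV ?pnatr_eq0 //; ring|ring]).
have dT : left_inner_divisor D (ex_Theta th).
  (* D^* Theta = diag(th, 1) U^*. *)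
  split => //; exists (fun z => mx2 (s * th z) (s * th z) s (- s)); split.
    by apply: H2_mx2; try exact: H2Z; exact: H2_cst.
  apply: aeT_circle => z z1; apply/matrixP => i j.
  rewrite !mxE !big_ord_recl big_ord0 !mxE /=.
  case: (ord2P i) => ->; case: (ord2P j) => -> /=; try by ring.
    by transitivity ((s * s + s * s) * th z); [rewrite ss h2 mul1r|ring].
  by transitivity ((s * s + s * s) * th z); [rewrite ss h2 mul1r|ring].
have [U [_ _ _ /(@eqT_entry _ _ _ _ _ 0 1) E]] := H _ D dB dT.
(* The entry (0, 1) of D is s th, and 2 s s = 1, so a constant D would make th constant. *)
apply: (@th_nonconstant_ae (2 * s * U 0 1)).
apply: (aeTW _ E) => z _ <-; rewrite mxE /=.
by rewrite mulrA -[2 * s * s]mulrA ss mulfV ?pnatr_eq0 // mul1r.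
Qed.

End Kernel.

(** * Common inner divisors of a scalar perturbation and Theta *)

Section Coprime.
Variable R : realType.
Local Notation C := R[i].
Local Notation H2 := (@H2 R).
Local Notation L2 := (@L2 R).

(* Comparing D G = c I with D^* D = I gives D^* = G / c, so both D and D^* are analytic. *)
Lemma inner_divisor_scalar n m (D : C -> 'M[C]_(n, m)) (G : C -> 'M[C]_(m, n)) (c : C) :
  c != 0 -> (m <= n)%N -> mx_inner D -> entries H2 G ->
  eqT (fun=> c%:M) (fun z => D z *m G z) ->
  exists U : 'M[C]_(n, m), [/\ m = n, U *m U^t* = 1%:M, U^t* *m U = 1%:M & eqT D (fun=> U)].
Proof.
move=> c0 mn [HD iD] HG E.
have Emn : m = n.
  apply/eqP; rewrite eqn_leq mn /=.
  have [z _ Ez] := aeT_ex E.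
  (* c I has rank n and factors through D, which has m columns, hence n <= m. *)
  rewrite -[leqLHS](@mxrank1 C n) -(mxrank_scale_nz _ c0) scalemx1 Ez.
  by apply: leq_trans (mxrankM_maxl _ _) _; exact: rank_leq_col.
subst m.
have DG : eqT (fun z => (D z)^t*) (fun z => c^-1 *: G z).
  apply: (aeTW _ (aeT_and E iD)) => z _ [E1 E2].
  rewrite -[G z]mul1mx -E2 -mulmxA -E1 mul_mx_scalar scalerA mulVf // scale1r //.
have cst i j : exists u : C, eqT (fun z => D z i j) (fun=> u).
  have [_ Hij] := HD i j; apply: H2_conj_cst => //.
  apply: (@H2_ae _ _ (fun z => c^-1 * G z j i)).
  - by apply: L2J; exact: H2_L2.
  - by apply: (aeTW _ DG) => z _ /matrixP /(_ j i); rewrite !mxE.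
  - exact: H2Z.
pose u i j := sval (cid (cst i j)).
have Hu i j : eqT (fun z => D z i j) (fun=> u i j) := svalP (cid (cst i j)).
pose U := \matrix_(i, j) u i j.
have EU : eqT D (fun=> U).
  by apply: eqT_mx => i j; apply: (aeTW _ (Hu i j)) => z _ ->; rewrite mxE.
have [z _ [Ez Dz]] := aeT_ex (aeT_and EU iD).
have UU : U^t* *m U = 1%:M by rewrite -Dz Ez.
by exists U; split => //; exact: mulmx1C.
Qed.

(** Since th K = Theta K, a common divisor of c I + th K and Theta also divides their combination c
    I. *)
Lemma left_coprime_scalar n (c : C) (th : C -> C) (K : 'M[C]_n) : c != 0 ->
  left_coprime (fun z => c%:M + th z *: K) (fscalar n th).
Proof.
move=> c0 m D [mn iD [G1 [HG1 E1]]] [_ _ [G2 [HG2 E2]]].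
apply: (@inner_divisor_scalar _ _ D (fun z => G1 z - G2 z *m K) c) => //.
  move=> i j; under eq_fun do rewrite !mxE.
  apply: H2B; first exact: HG1.
  have H2sum (s : seq 'I_n) : H2 (fun z => \sum_(k <- s) G2 z i k * K k j).
    elim: s => [|k s IH]; first by under eq_fun do rewrite big_nil; exact: H2_cst.
    under eq_fun do rewrite big_cons mulrC.
    by apply: H2D => //; apply: H2Z; exact: HG2.
  exact: H2sum.
apply: (aeTW _ (aeT_and E1 E2)) => z _ [e1 e2].
by rewrite mulmxBr mulmxA -e1 -e2 /fscalar mul_scalar_mx addrK.
Qed.

End Coprime.

(** * The hypotheses of the theorem *)

Section Hypotheses.
Variable R : realType.
Local Notation C := R[i].
Local Notation intT := (@intT R).
Local Notation H2 := (@H2 R).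
Variable th : C -> C.
Hypothesis tth : tractable th.
Local Notation Phi := (ex_Phi th).

Definition ex_plus (z : C) : 'M[C]_2 :=
  mx2 (2 * th z + (th 0)^*) (th 0)^* (th 0)^* (2 * th z + (th 0)^*).

(** The pairing of conj th - conj th(0) with k is the conjugate of the mean of th k - th(0) k, which
    is zero by the last clause of [tractable]. *)
Lemma hproj_thJ : hproj (fun z => (th z)^*) (fun=> (th 0)^*).
Proof.
split; [by apply: L2J; apply: L2_bdd; exact: bdd_th|exact: H2_cst|] => k Hk.
have i1 : itg (fun z => th z * k z) by apply: itg_L2; apply: H2_L2; exact: H2_thM.
have i2 : itg k by apply: itg_L2; exact: H2_L2.
rewrite -[RHS]conjC0 -[in RHS](subrr (th 0 * intT k)) -{1}(intT_thM tth Hk) -intTZ //.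
rewrite -intTB //; last exact: itgZ.
rewrite -intTJ; last by apply: itgD => //; apply: itgN; exact: itgZ.
by apply: intT_congr => z _; rewrite rmorphB !rmorphM /=; ring.
Qed.

Lemma ex_Phi_hproj i j : hproj (fun z => Phi z i j) (fun z => ex_plus z i j).
Proof.
have h2 : hproj (fun z => 2 * th z + (th z)^*) (fun z => 2 * th z + (th 0)^*).
  apply: hprojD; last exact: hproj_thJ.
  by apply: hproj_H2; apply: H2Z; exact: H2_th.
rewrite /ex_Phi /ex_plus; under [X in hproj X _]eq_fun do rewrite mxE.
under [X in hproj _ X]eq_fun do rewrite mxE.
by case: (ord2P i) => ->; case: (ord2P j) => -> //=; exact: hproj_thJ.
Qed.

Lemma plus_part_ex : eqT (plus_part Phi) ex_plus.
Proof.
apply: eqT_mx => i j; apply: (@hproj_inj _ (fun z => Phi z i j)); last exact: ex_Phi_hproj.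
apply: proj_hproj => i' j'; eexists; exact: ex_Phi_hproj.
Qed.

Lemma minus_part_ex : eqT (minus_part Phi) (fun z => (th z - th 0) *: @ones2 R).
Proof.
have E z : Phi z - ex_plus z = (th z - th 0)^* *: @ones2 R.
  apply/matrixP => i j; rewrite rmorphB.
  by case: (ord2P i) => ->; case: (ord2P j) => ->; rewrite !mxE /=; ring.
apply: (aeTW _ plus_part_ex) => z _; rewrite /minus_part /fadj /plus_part => ->.
rewrite E; apply/matrixP => i j.
by case: (ord2P i) => ->; case: (ord2P j) => ->; rewrite !mxE /= !mulr1 conjCK.
Qed.

Lemma Hinf_bdd (f : C -> C) : bddT f -> H2 f -> Hinf f.
Proof. by move=> bf Hf; split => //; exact: Linf_bdd. Qed.

Lemma scalar_inner_th : scalar_inner th.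
Proof.
split; first by apply: Hinf_bdd; [exact: bdd_th|exact: H2_th].
by apply: aeT_circle; case: tth.
Qed.

Lemma scalar_inner_1 : scalar_inner (fun=> 1 : C).
Proof.
split; first by apply: Hinf_bdd; [exact: bddT_cst|exact: H2_cst].
by apply: aeT_circle => z _; rewrite normr1.
Qed.

Lemma bounded_type_div (f g : C -> C) : bddT g -> H2 g ->
  (forall z, `|z| = 1 -> f z * th z = g z) -> bounded_type f.
Proof.
move=> bg Hg E; exists g, th; split.
- exact: Hinf_bdd.
- by case: scalar_inner_th.
- apply: aeT_circle => z z1; have t0 : th z != 0.
    apply/eqP => t0; have := th_unimodular tth z1.
    by rewrite t0 mul0r => /eqP; rewrite eq_sym oner_eq0.
  by split => //; rewrite -E // mulfK.
Qed.

Lemma bounded_type_ex : entries (@bounded_type R) Phi.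
Proof.
have Hth := H2_th tth; have bth := bdd_th tth.
have b1 : bounded_type (fun z => (th z)^*).
  apply: (@bounded_type_div _ (fun=> 1)); [exact: bddT_cst|exact: H2_cst|].
  by move=> z z1; rewrite mulrC th_unimodular.
have b2 : bounded_type (fun z => 2 * th z + (th z)^*).
  apply: (@bounded_type_div _ (fun z => 2 * (th z * th z) + 1)).
  - by apply: bddTD; [apply: bddTM; [exact: bddT_cst|exact: bddTM]|exact: bddT_cst].
  - by apply: H2D; [apply: H2Z; exact: H2_thM|exact: H2_cst].
  - by move=> z z1; rewrite mulrDl [(th z)^* * _]mulrC th_unimodular // mulrA.
move=> i j; rewrite /ex_Phi; under eq_fun do rewrite mxE.
by case: (ord2P i) => ->; case: (ord2P j) => ->.
Qed.

Lemma bounded_type_ex_adj : entries (@bounded_type R) (fadj Phi).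
Proof.
have Hth := H2_th tth; have bth := bdd_th tth.
have b1 : bounded_type th.
  apply: (@bounded_type_div _ (fun z => th z * th z)); [exact: bddTM|exact: H2_thM|by []].
have b2 : bounded_type (fun z => 2 * (th z)^* + th z).
  apply: (@bounded_type_div _ (fun z => 2 + th z * th z)).
  - by apply: bddTD; [exact: bddT_cst|exact: bddTM].
  - by apply: H2D; [exact: H2_cst|exact: H2_thM].
  - by move=> z z1; rewrite mulrDl -mulrA [(th z)^* * _]mulrC th_unimodular // mulr1.
move=> i j; rewrite /fadj; under eq_fun do rewrite ex_Phi_adj mxE.
by case: (ord2P i) => ->; case: (ord2P j) => ->.
Qed.

(** Solving A^* Theta = Phi_+ and B^* Theta = Phi_- on the circle gives A = th Phi_+^* and B = th
    Phi_-^*. The first has the form c I + th K treated in [left_coprime_scalar]. *)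
Definition ex_A (z : C) : 'M[C]_2 := 2%:M + th z *: (th 0 *: @ones2 R).
Definition ex_B (z : C) : 'M[C]_2 := (1 - (th 0)^* * th z) *: @ones2 R.

Lemma abrahamse_hyp_ex : abrahamse_hyp Phi ex_A ex_B (fun=> 1) th.
Proof.
have Hth := H2_th tth.
split; first by move=> i j; apply: Linf_bdd; exact: bdd_ex.
split; first exact: bounded_type_ex.
split; first exact: bounded_type_ex_adj.
split; first exact: scalar_inner_1.
split; first exact: scalar_inner_th.
split.
  move=> i j; rewrite /ex_A; under eq_fun do rewrite !mxE mulrC.
  by apply: H2D; [exact: H2_cst|exact: H2Z].
split.
  move=> i j; rewrite /ex_B; under eq_fun do rewrite !mxE mulrC.
  by apply: H2Z; apply: H2B; [exact: H2_cst|exact: H2Z].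
split.
  apply: (aeTW _ plus_part_ex) => z z1 ->.
  rewrite /fscalar mulmx1 mul_mx_scalar; apply/matrixP => i j.
  case: (ord2P i) => ->; case: (ord2P j) => ->; rewrite !mxE /= ?mulr1n ?mulr0n
    ?rmorphD ?rmorphM /= ?rmorph_nat ?conjC0 ?rmorph1 ?mulr1 ?mulrDr ?th_thJ //; ring.
split.
  apply: (aeTW _ minus_part_ex) => z z1 ->.
  rewrite /fscalar mul_mx_scalar; apply/matrixP => i j.
  by case: (ord2P i) => ->; case: (ord2P j) => ->; rewrite !mxE /= ?mulr1
    ?rmorphB ?rmorphM /= ?rmorph1 ?conjCK ?mulr1 mulrBr mulr1 [th 0 * _]mulrC th_thJ.
split; first by apply: left_coprime_scalar; rewrite pnatr_eq0.
by split; [exact: hyponormal_ex|exact: invariant_ex].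
Qed.

End Hypotheses.

(** * The normal symbol, the contraction K and the refutation *)

Section NormK.
Variable R : realType.
Local Notation C := R[i].

Lemma normal_ex (th : C -> C) : normal_symbol (ex_Phi th).
Proof.
apply: aeT_circle => z _; rewrite ex_Phi_adj; apply/matrixP => i j.
rewrite !mxE !big_ord_recl !big_ord0 !mxE /=.
by case: (ord2P i) => ->; case: (ord2P j) => -> /=; ring.
Qed.

Lemma vnorm2 (v : 'cV[C]_2) : vnorm v = Num.sqrt (sqn (v 0 0) + sqn (v 1 0)).
Proof.
rewrite /vnorm !big_ord_recl big_ord0 addr0 !normc_sqr.
by have -> : lift ord0 ord0 = 1 :> 'I_2 by exact: val_inj.
Qed.

Lemma ex_K_mulmx (z : C) (v : 'cV[C]_2) i : (ex_K z *m v) i 0 = 2^-1 * (v 0 0 + v 1 0).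
Proof.
rewrite mxE !big_ord_recl big_ord0 !mxE /=.
have -> : lift ord0 ord0 = 1 :> 'I_2 by exact: val_inj.
by case: (ord2P i) => -> /=; ring.
Qed.

Lemma sqn_half : sqn (2^-1 : C) = 4^-1.
Proof.
apply: (@complexI R); rewrite -normCK_sqn.
rewrite fmorphV rmorph_nat fmorphV !rmorph_nat /= -invfM -natrM //.
Qed.

(** K is the orthogonal projection onto the span of (1, 1): [sqnD_le] gives the bound, and the unit
    vector (1, 1) / sqrt 2 attains it. *)
Lemma opnorm_ex_K (z : C) : opnorm (@ex_K R z) = 1%E.
Proof.
apply/eqP; rewrite eq_le; apply/andP; split.
  apply: ge_ereal_sup => _ [v /= v1 <-]; rewrite lee_fin; apply: le_trans v1.
  rewrite !vnorm2 !ex_K_mulmx ler_sqrt; last exact: (addr_ge0 (sqn_ge0 _) (sqn_ge0 _)).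
  rewrite sqnM sqn_half; have := sqnD_le (v 0 0) (v 1 0).
  by have := sqn_ge0 (v 0 0); have := sqn_ge0 (v 1 0); lra.
have hs : sqn (sqrt_half R) = 2^-1.
  apply: (@complexI R); rewrite -normCK_sqn sqrt_halfJ sqrt_half_sqr.
  by rewrite fmorphV rmorph_nat.
apply: le_ereal_sup_tmp.
exists (vnorm (@ex_K R z *m const_mx (sqrt_half R)))%:E.
  by exists (const_mx (sqrt_half R)) => //=; rewrite vnorm2 !mxE hs -[2^-1]mul1r -splitr sqrtr1.
have hh : 2^-1 * (sqrt_half R + sqrt_half R) = sqrt_half R.
  by rewrite -mulr2n -[sqrt_half R *+ 2]mulr_natl mulrA mulVf ?mul1r // pnatr_eq0.
rewrite vnorm2 !ex_K_mulmx !mxE hh hs.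
by rewrite -[2^-1]mul1r -splitr sqrtr1.
Qed.

Lemma norm_inf_ex_K : norm_inf (@ex_K R) = 1%E.
Proof.
rewrite /norm_inf (_ : [set _ | _ in _] = [set 1%E]) ?ereal_sup1 //.
apply/seteqP; split=> [_ [z _ <-]|_ ->] /=; first exact: opnorm_ex_K.
by exists 1; [exact: normr1|exact: opnorm_ex_K].
Qed.

(** With 2 K = J and K J = J the terms conj th J cancel, and 2 th I - th J remains. *)
Lemma ex_Phi_sub_K (th : C -> C) : tractable th ->
  entries (@Hinf R) (fun z => ex_Phi th z - @ex_K R z *m (ex_Phi th z)^t*).
Proof.
move=> tth i j; have Hth := H2_th tth; have bth := bdd_th tth.
have E z : ex_Phi th z - @ex_K R z *m (ex_Phi th z)^t* =
  mx2 (th z) (-1 * th z) (-1 * th z) (th z).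
  rewrite ex_Phi_adj; apply/matrixP => i' j'.
  rewrite !mxE !big_ord_recl big_ord0 !mxE /=.
  by case: (ord2P i') => ->; case: (ord2P j') => -> /=; field; rewrite ?pnatr_eq0.
under eq_fun do rewrite E mxE.
have h1 : Hinf th by exact: Hinf_bdd.
have h2 : Hinf (fun z => -1 * th z).
  by apply: Hinf_bdd; [apply: bddTM => //; exact: bddT_cst|exact: H2Z].
by case: (ord2P i) => ->; case: (ord2P j) => ->.
Qed.

Lemma blaschke_id : finite_blaschke (fun z : C => z).
Proof.
exists 1, [:: 0]; split; rewrite ?normr1 //=; first by rewrite normr0 ltr01.
by move=> z _; rewrite big_seq1 conjC0 mul0r !subr0 divr1 mul1r.
Qed.

Lemma nonconstant_id : nonconstant (fun z : C => z).
Proof.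
case=> c E; have := E 0; rewrite normr0 => /(_ ler01) e0.
have := E 1; rewrite normr1 lexx -e0 => /(_ isT) /eqP.
by rewrite oner_eq0.
Qed.

(** A single instance suffices: n = 2 and th(z) = z. *)
Lemma abrahamse_without_B_coprime_false : ~ abrahamse_without_B_coprime R.
Proof.
move=> H; have fb := blaschke_id; have t := tractable_blaschke fb.
have [a a1 za] := blaschke_zero fb nonconstant_id.
have [] := H 2 _ _ _ _ _ isT (abrahamse_hyp_ex t).
  exact: (not_normal_ex t a1 za).
exact: (not_analytic_ex t a1 za).
Qed.

End NormK.
Unset Implicit Arguments.

Theorem mainTheorem2 (R : realType) :
  ~ abrahamse_without_B_coprime R /\
  forall th : R[i] -> R[i], finite_blaschke th -> nonconstant th ->
  let Phi := ex_Phi th in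
  let Theta := ex_Theta th in
  let TPhi := toeplitz Phi in
  let N := oker (selfcomm TPhi) in
  (* the decomposition of Phi *)
  [/\ entries (@H2 R) (fun z => 2 *: Theta z),
      entries (@H2 R) (fun z => mx2 (th z) (th z) (th z) (th z)),
      eqT Phi (fun z => (mx2 (th z) (th z) (th z) (th z))^t* + 2 *: Theta z),
      eqT (fun z => mx2 (th z) (th z) (th z) (th z))
          (fun z => (@ones2 R)^t* *m Theta z) &
      th 0 = 0 ->
        [/\ eqT (plus_part Phi) (fun z => 2 *: Theta z),
            eqT (minus_part Phi) (fun z => mx2 (th z) (th z) (th z) (th z)) &
            abrahamse_hyp Phi (fun=> 2 *: 1%:M) (fun=> @ones2 R) (fun=> 1) th]] /\
  (* also when th 0 <> 0, the theorem's hypotheses hold with Theta_0 = I_2 and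
     Theta_2 = Theta, except the one on B *)
  (exists A B : R[i] -> 'M[R[i]]_2,
     abrahamse_hyp Phi A B (fun=> 1) th /\ ~ left_coprime B Theta) /\
  [/\ normal_symbol Phi, norm_inf (@ex_K R) = 1%E,
      entries (@Hinf R) (fun z => Phi z - @ex_K R z *m (Phi z)^t*) &
      hyponormal TPhi] /\
  [/\ orth_sum N (ThetaH2 th) (diag_model th), invariant_under TPhi N &
      exists2 F : R[i] -> 'cV[R[i]]_2, entries (@H2 R) F & ~ N F] /\
  [/\ ~ normal_oper TPhi, ~ analytic_symbol Phi,
      left_coprime (fun=> 2 *: 1%:M) Theta &
      ~ left_coprime (fun=> @ones2 R) Theta].
Proof.
split; first exact: abrahamse_without_B_coprime_false.
move=> th fb nc Phi Theta TPhi N.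
have t := tractable_blaschke fb; have [a a1 za] := blaschke_zero fb nc.
have Hth := H2_th t.
have ET : Theta = fscalar 2 th := fscalar_ex_Theta th.
have H1 : H2 (fun=> 1 : R[i]) by exact: H2_cst.
(* When th(0) = 0 the general [ex_A] and [ex_B] become 2 I and J, so [abrahamse_hyp_ex] serves both
   existence claims. *)
have EA0 : th 0 = 0 -> ex_A th = (fun=> 2 *: 1%:M).
  by move=> t0; apply/funext => z; rewrite /ex_A t0 scale0r scaler0 addr0 scalemx1.
have EB0 : th 0 = 0 -> ex_B th = (fun=> @ones2 R).
  by move=> t0; apply/funext => z; rewrite /ex_B t0 conjC0 mul0r subr0 scale1r.
have nB (B : R[i] -> 'M[R[i]]_2) b : H2 b -> (B = fun z => b z *: @ones2 R) ->
    ~ left_coprime B Theta.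
  by move=> Hb ->; exact: (not_left_coprime_ones2 t a1 za Hb).
split; [split|split; [|split; [split|split; [split|split]]]].
- move=> i j; rewrite /Theta /ex_Theta; under eq_fun do rewrite mxE.
  by apply: H2Z; move: i j; apply: H2_mx2 => //; exact: H2_cst.
- exact: H2_mx2.
- apply: aeT_circle => z _; apply/matrixP => i j.
  by case: (ord2P i) => ->; case: (ord2P j) => ->; rewrite !mxE /=; ring.
- apply: aeT_circle => z _; rewrite ET /fscalar mul_mx_scalar; apply/matrixP => i j.
  by case: (ord2P i) => ->; case: (ord2P j) => ->; rewrite !mxE /= rmorph1 mulr1.
- move=> t0; split.
  + apply: (aeTW _ (plus_part_ex t)) => z _ ->; apply/matrixP => i j.
    by case: (ord2P i) => ->; case: (ord2P j) => ->; rewrite !mxE /= t0 conjC0; ring.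
  + apply: (aeTW _ (minus_part_ex t)) => z _ ->; apply/matrixP => i j.
    by case: (ord2P i) => ->; case: (ord2P j) => ->; rewrite !mxE /= t0; ring.
  + by rewrite -EA0 // -EB0 //; exact: abrahamse_hyp_ex.
- exists (ex_A th), (ex_B th); split; first exact: abrahamse_hyp_ex.
  by apply: (nB _ (fun z => 1 - (th 0)^* * th z)) => //; apply: H2B => //; exact: H2Z.
- exact: normal_ex.
- exact: norm_inf_ex_K.
- exact: ex_Phi_sub_K.
- exact: hyponormal_ex.
- exact: orth_sum_ex.
- exact: invariant_ex.
- exact: (not_oker_ex t a1 za).
- exact: (not_normal_ex t a1 za).
- exact: (not_analytic_ex t a1 za).
(* 2 I is read as 2 I + th K with K = 0 to fit [left_coprime_scalar]. *)
- rewrite ET (_ : (fun=> _) = fun z => 2%:M + th z *: 0).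
    by apply: left_coprime_scalar; rewrite pnatr_eq0.
  by apply/funext => z; rewrite scaler0 addr0 scalemx1.
- by apply: (nB _ (fun=> 1)) => //; apply/funext => z; rewrite scale1r.
Qed.
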